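(* Let $0<q,t<1$, $\gamma>0$, $\beta>0$. Suppose that $(\lambda(\tau):\tau\in\mathbb{R})$ obeys the law of the stationary $\beta$-periodic Macdonald Plancherel process of intensity $\gamma$, and take a sequence $0=b_{0}<b_{1}<\cdots<b_{n}<b_{n+1}=\beta$. Let $\boldsymbol{\rho}^{+}=(\rho^{+}_{0},\dots,\rho^{+}_{n})$ and $\boldsymbol{\rho}^{-}=(\rho^{-}_{1},\dots,\rho^{-}_{n+1})$ be the sequences of Plancherel specializations $$\rho^{+}_{0}=\rho_{\gamma(1-e^{b_{n}-\beta})},\qquad \rho^{+}_{i}=\rho_{\gamma(e^{b_{i}}-e^{b_{i-1}})}\ (i=1,\dots,n),\qquad \rho^{-}_{i}=\rho_{\gamma(e^{-b_{i-1}}-e^{-b_{i}})}\ (i=1,\dots,n+1).$$ Then the joint law of $\lambda(b_{i})$, $i=0,1,\dots,n$, is the corresponding $(n+1)$-step periodic Macdonald process at $u=e^{-\beta}$: for all partitions $\lambda^0,\dots,\lambda^n$, $$\mathrm{Prob}\left(\lambda(b_{i})=\lambda^{i},\ i=0,1,\dots,n\right)=\mathbb{P}^{\boldsymbol{\rho}^{+},\boldsymbol{\rho}^{-}}_{q,t;e^{-\beta}}(\lambda^{0},\lambda^{1},\dots,\lambda^{n}).$$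
   Context: $\mathbb{Y}$ is the set of all partitions. $\Lambda$ is the ring of symmetric functions with the bilinear form $\langle p_\lambda,p_\mu\rangle_{q,t}=\delta_{\lambda\mu}\prod_{i} m_i(\lambda)!\,i^{m_i(\lambda)}\prod_{i=1}^{\ell(\lambda)}\frac{1-q^{\lambda_i}}{1-t^{\lambda_i}}$; $P_\lambda=P_\lambda(q,t)$ are the Macdonald symmetric functions and $Q_\lambda=P_\lambda/\langle P_\lambda,P_\lambda\rangle_{q,t}$. Skew functions: $P_\lambda(X,Y)=\sum_\mu P_{\lambda/\mu}(X)P_\mu(Y)$, $Q_\lambda(X,Y)=\sum_\mu Q_{\lambda/\mu}(X)Q_\mu(Y)$. For $\xi>0$ the Plancherel specialization $\rho_\xi:\Lambda\to\mathbb{R}$ is given by $\rho_\xi(p_n)=\xi\delta_{n,1}$. Fock space: the Heisenberg algebra generated by $a_n$, $n\in\mathbb{Z}\setminus\{0\}$, with $[a_{m},a_{n}]=m\frac{1-q^{|m|}}{1-t^{|m|}}\delta_{m+n,0}$ acts on the Fock space $\mathcal{F}$ generated by a vacuum $|0\rangle$ with $a_n|0\rangle=0$ for $n>0$; the dual right module $\mathcal{F}^\dagger$ is generated by $\langle 0|$ with $\langle 0|a_{-n}=0$ for $n>0$; the pairing satisfies $\langle0|0\rangle=1$ and $\langle v|a_n\cdot|w\rangle$ is unambiguous. Both $\mathcal{F}$ and $\mathcal{F}^\dagger$ are identified with $\Lambda$ via $a_{-\lambda_1}\cdots a_{-\lambda_\ell}|0\rangle\leftrightarrow p_\lambda$ and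 $\langle0|a_{\lambda_1}\cdots a_{\lambda_\ell}\leftrightarrow p_\lambda$; $|F\rangle,\langle F|$ denote the vectors corresponding to $F\in\Lambda$, so $\langle F|G\rangle=\langle F,G\rangle_{q,t}$. $D$ is the degree operator, $D\,a_{-\lambda_1}\cdots a_{-\lambda_\ell}|0\rangle=|\lambda|\,a_{-\lambda_1}\cdots a_{-\lambda_\ell}|0\rangle$. Put $\Gamma(\rho)_{\pm}=\exp\left(\sum_{n>0}\frac{1-t^{n}}{1-q^{n}}\frac{p_{n}(\rho)}{n}a_{\pm n}\right)$, so $\Gamma(\rho_\xi)_\pm=\exp\left(\xi\frac{1-t}{1-q}a_{\pm1}\right)$. For $v\in(0,1)$ let $\mathcal{T}^{(\gamma)}(v)=e^{\frac{1-t}{1-q}\gamma^{2}(v-1)}\Gamma(\rho_{\gamma(1-v)})_{-}v^{D}\Gamma(\rho_{\gamma(1-v)})_{+}$ and $T^{(\gamma)}_{\lambda\mu}(v)=\langle P_{\lambda}|\mathcal{T}^{(\gamma)}(v)|Q_{\mu}\rangle$. The stationary $\beta$-periodic Macdonald Plancherel process of intensity $\gamma$ is the $\mathbb{Y}$-valued stochastic process $(\lambda(\tau):\tau\in\mathbb{R})$ with $\lambda(\tau+\beta)=\lambda(\tau)$ a.s. whose finite-dimensional laws, for $0=b_{0}<b_{1}<\cdots<b_{n}<b_{n+1}=\beta$, are $$\mathrm{Prob}\left(\lambda(b_{i})=\lambda^{i},i=0,\dots,n\right)=(e^{-\beta};e^{-\beta})_{\infty}\prod_{i=0}^{n}T^{(\gamma)}_{\lambda^{i},\lambda^{i+1}}(e^{-(b_{i+1}-b_{i})}),\qquad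 \lambda^{n+1}:=\lambda^0,$$ where $(a;u)_\infty=\prod_{k\ge0}(1-au^k)$. $N$-step periodic Macdonald process ($0<u<1$): $\mathbb{P}^{\boldsymbol{\rho}^{+},\boldsymbol{\rho}^{-}}_{q,t;u}(\lambda^{1},\dots,\lambda^{N})\propto\sum_{\boldsymbol{\mu}\in\mathbb{Y}^{N}}u^{|\mu^{N}|}\prod_{i=1}^{N}Q_{\lambda^{i}/\mu^{i}}(\rho^{-}_{i};q,t)P_{\lambda^{i+1}/\mu^{i}}(\rho^{+}_{i};q,t)$ with $\lambda^{N+1}=\lambda^1$, $\rho^+_N=\rho^+_0$, normalized to a probability measure on $\mathbb{Y}^N$. In the claim $N=n+1$ and $(\lambda^0,\dots,\lambda^n)$ are its arguments in order (first argument $\lambda^0$). *)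

(* Defs.v *)
From HB Require Import structures.
From mathcomp Require Import all_boot all_order all_algebra finmap.
From mathcomp.multinomials Require Import monalg.
From mathcomp Require Import all_classical all_reals all_analysis.
From mathcomp Require Import ring lra zify.
Set Implicit Arguments.
Unset Strict Implicit.
Unset Printing Implicit Defensive.
Import Order.TTheory GRing.Theory Num.Theory.
Import numFieldNormedType.Exports.
Local Open Scope classical_set_scope.
Local Open Scope ring_scope.

(** * Partitions *)

Definition is_intpart (s : seq nat) := sorted geq s && all (leq 1) s.

Record intpart := IntPart { parts :> seq nat; intpartP : is_intpart parts }.

HB.instance Definition _ := [isSub for parts].
HB.instance Definition _ := [Countable of intpart by <:].

Lemma is_intpart_union (s1 s2 : intpart) : is_intpart (sort geq (s1 ++ s2)).
Proof.
case: s1 s2 => [s1 /andP[_ h1]] [s2 /andP[_ h2]] /=; apply/andP; split.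
  by apply: sort_sorted => x y; rewrite /geq /= leq_total.
by rewrite all_sort all_cat h1 h2.
Qed.

Lemma is_intpart_nil : is_intpart [::]. Proof. by []. Qed.

Definition nilpart : intpart := IntPart is_intpart_nil.

Definition unionpart (l m : intpart) : intpart := IntPart (is_intpart_union l m).

Lemma geq_trans : transitive geq.
Proof. by move=> y x z /= h1 h2; exact: leq_trans h2 h1. Qed.

Lemma geq_anti : antisymmetric geq.
Proof. by move=> x y; rewrite andbC; exact: anti_leq. Qed.

Lemma geq_total : total geq.
Proof. by move=> x y; rewrite /geq /= leq_total. Qed.

Lemma intpart_perm (l m : intpart) : perm_eq l m -> l = m.
Proof.
case: l m => [s1 h1] [s2 h2] /= h; apply: val_inj => /=.
have [/andP[S1 _] /andP[S2 _]] := (h1, h2).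
exact: (sorted_eq geq_trans geq_anti S1 S2 h).
Qed.

Lemma unionpart_perm l m : perm_eq (unionpart l m) (l ++ m).
Proof. by rewrite /= perm_sort. Qed.

Lemma unionpartC : commutative unionpart.
Proof.
move=> l m; apply: intpart_perm.
by rewrite (perm_trans (unionpart_perm _ _)) // perm_catC perm_sym unionpart_perm.
Qed.

Lemma unionpartA : associative unionpart.
Proof.
move=> l m k; apply: intpart_perm => /=.
rewrite !perm_sort perm_sym perm_sort.
apply: (@perm_trans _ ((l ++ m) ++ k)).
  by rewrite perm_cat2r perm_sort.
by rewrite -catA perm_cat2l perm_sym perm_sort.
Qed.

Lemma union1part : left_id nilpart unionpart.
Proof. by move=> l; apply: intpart_perm; rewrite /= perm_sort. Qed.

Lemma unionpart1 : right_id nilpart unionpart.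
Proof. by move=> l; rewrite unionpartC union1part. Qed.

Lemma unionpart_unit l m : unionpart l m = nilpart -> l = nilpart /\ m = nilpart.
Proof.
move=> /(congr1 (size \o parts)) /=; rewrite size_sort size_cat => /eqP.
rewrite addn_eq0 !size_eq0 => /andP[/eqP h1 /eqP h2].
by split; apply: val_inj.
Qed.

HB.instance Definition _ := Choice_isMonomialDef.Build intpart
  unionpartA union1part unionpart1 unionpart_unit.
HB.instance Definition _ := MonomialDef_isConomialDef.Build intpart unionpartC.

Definition weight (l : intpart) : nat := sumn l.

Lemma is_intpart_row k : is_intpart (nseq (0 < k) k).
Proof. by case: k. Qed.

(* the one-row partition (k); the empty partition for k = 0 *)
Definition rowpart (k : nat) : intpart := IntPart (is_intpart_row k).

Lemma is_intpart_rem k (l : intpart) : is_intpart (rem k l).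
Proof.
case: l => [s /andP[h1 h2]] /=; apply/andP; split.
  exact: (subseq_sorted geq_trans (rem_subseq k s) h1).
by apply/allP => x /mem_rem; exact/allP.
Qed.

Definition rempart (k : nat) (l : intpart) : intpart :=
  IntPart (is_intpart_rem k l).

Lemma intpart_count (l m : intpart) :
  (forall k, count_mem k l = count_mem k m) -> l = m.
Proof. by move=> h; apply: intpart_perm; apply/allP => k _ /=; rewrite h. Qed.

Lemma count_mem_rowU j k (l : intpart) : (0 < k)%N ->
  count_mem j (unionpart (rowpart k) l) = ((k == j) + count_mem j l)%N.
Proof.
move=> k0; rewrite (permP (unionpart_perm _ _)) count_cat /= k0 /=; lia.
Qed.

Lemma count_mem_rempart j k (l : intpart) :
  count_mem j (rempart k l) = (count_mem j l - ((k == j) && (k \in parts l)))%N.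
Proof. by rewrite /= count_rem andbC. Qed.

Lemma mem_parts j (l : intpart) : (j \in parts l) = (0 < count_mem j l)%N.
Proof. by rewrite -has_pred1 has_count. Qed.

Lemma mem_rempart j k (l : intpart) :
  (j \in parts (rempart k l)) = ((k == j) < count_mem j l)%N.
Proof.
rewrite -has_pred1 has_count count_mem_rempart subn_gt0.
case: eqVneq => [->|//] /=; case: (boolP (j \in _)) => //.
by rewrite -has_pred1 has_count lt0n negbK => /eqP ->.
Qed.

Definition dominated (m l : intpart) : bool :=
  (weight m == weight l) &&
  [forall k : 'I_(weight l).+1, (sumn (take k m) <= sumn (take k l))%N].

(** * Symmetric functions *)

(* The ring of symmetric functions over a field of characteristic zero is the
   polynomial ring in the power sums p_1, p_2, ...; its monomials are the
   p_l = prod_i p_(l_i), l a partition, and p_l p_m = p_(l U m).  It is thus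
   the monoid algebra of the partitions under union. *)
Definition Lambda (R : realType) := {malg R[intpart]}.

HB.instance Definition _ (R : realType) := GRing.ComAlgebra.on (Lambda R).

Section SymmetricFunctions.
Context {R : realType}.
Implicit Types (F G : Lambda R) (l m : intpart) (q t : R).

Definition psum (k : nat) : Lambda R := << rowpart k >>.

Definition psum_prod (S : comNzRingType) (r : nat -> S) l : S :=
  \prod_(k <- parts l) r k.

Fact psum_prod_mmorphism (S : comNzRingType) (r : nat -> S) :
  mmorphism (psum_prod r).
Proof.
split; last by rewrite /psum_prod big_nil.
move=> l m; rewrite /psum_prod -big_cat; apply: perm_big.
exact: unionpart_perm.
Qed.

HB.instance Definition _ (S : comNzRingType) (r : nat -> S) :=
  isMultiplicative.Build intpart S (psum_prod r) (psum_prod_mmorphism r).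

(* the ring morphism out of Lambda extending f and mapping p_k to r k, k > 0 *)
Definition psum_morph (S : comNzRingType) (f : {rmorphism R -> S})
    (r : nat -> S) : Lambda R -> S :=
  mmap f (psum_prod r).

Fact psum_morph_is_additive (S : comNzRingType) (f : {rmorphism R -> S})
  (r : nat -> S) : additive (psum_morph f r).
Proof. exact: mmap_is_additive. Qed.

Fact psum_morph_is_multiplicative (S : comNzRingType) (f : {rmorphism R -> S})
  (r : nat -> S) : multiplicative (psum_morph f r).
Proof. exact: mmap_is_multiplicative. Qed.

HB.instance Definition _ (S : comNzRingType) (f : {rmorphism R -> S})
    (r : nat -> S) :=
  GRing.isAdditive.Build (Lambda R) S (psum_morph f r)
    (psum_morph_is_additive f r).
HB.instance Definition _ (S : comNzRingType) (f : {rmorphism R -> S})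
    (r : nat -> S) :=
  GRing.isMultiplicative.Build (Lambda R) S (psum_morph f r)
    (psum_morph_is_multiplicative f r).

Lemma psum_morphC (S : comNzRingType) (f : {rmorphism R -> S})
  (r : nat -> S) (a : R) : psum_morph f r a%:MP = f a.
Proof. exact: mmapC. Qed.

Lemma psum_morph_psum (S : comNzRingType) (f : {rmorphism R -> S})
  (r : nat -> S) k : (0 < k)%N -> psum_morph f r (psum k) = r k.
Proof.
move=> k0; rewrite /psum_morph /psum mmapU /= (rmorph1 f) mul1r /psum_prod /= k0.
exact: big_seq1.
Qed.

(* F(x_0, ..., x_(n-1)) *)
Definition invars (n : nat) : Lambda R -> {mpoly R[n]} :=
  psum_morph (@malgC 'X_{1..n} R)
    (fun k => \sum_(i < n) << ucm i >> ^+ k).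

(* the monomial symmetric polynomial m_l(x_0, ..., x_(n-1)); it is 0 when l
   has more than n parts *)
Definition monsym (n : nat) l : {mpoly R[n]} :=
  \sum_(a \in [set a : 'X_{1..n} |
                 perm_eq [seq e <- [seq a i | i <- enum 'I_n] | e != 0%N] l])
    (<< a >> : {mpoly R[n]}).

Definition zqt q t l : R :=
  (\prod_(k <- undup l) ((count_mem k l)`! * k ^ count_mem k l)%N%:R) *
  \prod_(k <- parts l) ((1 - q ^+ k) / (1 - t ^+ k)).

Definition form q t F G : R :=
  \sum_(l <- msupp F) F@_l * G@_l * zqt q t l.

(* The Macdonald symmetric functions P_l(q,t) are the unique family that is
   unitriangular on the monomial symmetric functions for the dominance order
   and orthogonal for the (q,t)-form; the coefficients c l m of the expansion
   do not depend on the number n of variables. *)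
Definition is_macdonald q t (P : intpart -> Lambda R) : Prop :=
  (exists c : intpart -> intpart -> R, forall l n,
     invars n (P l) = monsym n l +
       \sum_(m \in [set m | dominated m l && (m != l)]) c l m *: monsym n m) /\
  (forall l m, l != m -> form q t (P l) (P m) = 0).

Definition macdonaldQ q t (P : intpart -> Lambda R) l : Lambda R :=
  (form q t (P l) (P l))^-1 *: P l.

(** ** Skew functions *)

(* Functions of two sets of variables X, Y: polynomials in the p_k(Y) with
   coefficients in the ring of symmetric functions of X. *)
Definition Lambda2 := {malg (Lambda R)[intpart]}.

HB.instance Definition _ := GRing.ComAlgebra.on Lambda2.

Definition inX F : Lambda2 := F%:MP.
Definition inY : Lambda R -> Lambda2 :=
  psum_morph (@malgC intpart (Lambda R) \o @malgC intpart R)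
    (fun k => << rowpart k >>).

(* F(X, Y), from p_k(X, Y) = p_k(X) + p_k(Y) *)
Definition inXY : Lambda R -> Lambda2 :=
  psum_morph (@malgC intpart (Lambda R) \o @malgC intpart R)
    (fun k => inX (psum k) + inY (psum k)).

(* For a basis B of Lambda, skew B l is the unique family (B_(l/m))_m with
   B_l(X, Y) = sum_m B_(l/m)(X) B_m(Y), a sum with finite support. *)
Definition skew (B : intpart -> Lambda R) l : intpart -> Lambda R :=
  xget (fun=> 0) [set S : intpart -> Lambda R |
    inXY (B l) = \sum_(m \in [set: intpart]) inX (S m) * inY (B m)].

(** ** Specializations *)

Definition plancherel (xi : R) : Lambda R -> R :=
  psum_morph idfun (fun k => if k == 1%N then xi else 0).

End SymmetricFunctions.

(** * Fock space *)

(* A formal, possibly infinite, combination sum_l f l a_(-l_1)...a_(-l_r)|0>.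
   The Fock space is the subspace of the finite ones; Gamma_- maps it to
   infinite ones, so operators are defined on all formal combinations. *)
Definition Fock (R : realType) := intpart -> R.

Section FockSpace.
Context {R : realType}.
Variables q t : R.
Implicit Types (F G : Lambda R) (l m : intpart) (f : Fock R).

Definition vacuum : Fock R := fun l => (l == nilpart)%:R.

(* a_(-k) adds a part k; a_k maps a_(-l_1)...a_(-l_r)|0> to
   k (1-q^k)/(1-t^k) m_k(l) times the vector of l with one part k removed.
   The modes are indexed by nonzero integers; index 0 is unused. *)
Definition heis (n : int) f : Fock R :=
  match n with
  | Posz k => fun l =>
      k%:R * ((1 - q ^+ k) / (1 - t ^+ k)) *
      (count_mem k (unionpart (rowpart k) l))%:R * f (unionpart (rowpart k) l)
  | Negz k => fun l => if k.+1 \in parts l then f (rempart k.+1 l) else 0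
  end.

Definition ket F : Fock R := fun l => F@_l.

(* <F| f> = sum_l F_l <0| a_(l_1) ... a_(l_r) f>, where <0| w> is the
   coefficient of the vacuum in w *)
Definition bra F f : R :=
  \sum_(l <- msupp F)
    F@_l * (foldr (fun k w => heis k%:Z w) f (parts l)) nilpart.

Lemma heis_vacuum n : (0 < n)%N -> heis n vacuum = (fun=> 0).
Proof.
move=> n0; apply/funext => l; rewrite /heis /vacuum.
case: eqP => [/(congr1 (fun m : intpart => count_mem n m))|]; last by rewrite mulr0.
by rewrite count_mem_rowU // eqxx.
Qed.

Lemma heis_commPP (j k : nat) f l : (0 < j)%N -> (0 < k)%N ->
  heis j (heis k f) l = heis k (heis j f) l.
Proof.
move=> j0 k0; rewrite /heis !count_mem_rowU //.
have -> : unionpart (rowpart j) (unionpart (rowpart k) l) =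
          unionpart (rowpart k) (unionpart (rowpart j) l).
  by rewrite !unionpartA (unionpartC (rowpart j)).
rewrite (eq_sym k j); case: (eqVneq j k) => [e|_]; [subst k|rewrite !add0n]; ring.
Qed.

Lemma heis_commNN (j k : nat) f l :
  heis (Negz j) (heis (Negz k) f) l =
  heis (Negz k) (heis (Negz j) f) l.
Proof.
rewrite /=; have -> : rempart k.+1 (rempart j.+1 l) = rempart j.+1 (rempart k.+1 l).
  apply: intpart_count => i; rewrite !count_mem_rempart !mem_rempart !mem_parts.
  case: (eqVneq k.+1 j.+1) => [->//|kj].
  by rewrite -!subnDA addnC.
change (rem k.+1 l) with (parts (rempart k.+1 l)).
change (rem j.+1 l) with (parts (rempart j.+1 l)).
rewrite !mem_rempart !mem_parts.
case: (eqVneq j k) => [->//|njk].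
have -> : (j.+1 == k.+1) = false by apply/negbTE.
have -> : (k.+1 == j.+1) = false by rewrite eq_sym; apply/negbTE.
by do 2 case: ifP.
Qed.

Lemma heis_commPN (j k : nat) f l : (0 < j)%N ->
  heis j (heis (Negz k) f) l - heis (Negz k) (heis j f) l =
  if j == k.+1 then j%:R * ((1 - q ^+ j) / (1 - t ^+ j)) * f l else 0.
Proof.
move=> j0; rewrite /heis !mem_parts !count_mem_rowU //.
case: (eqVneq j k.+1) => [->|njk].
  rewrite eqxx addSn.
  have -> : rempart k.+1 (unionpart (rowpart k.+1) l) = l.
    apply: intpart_count => i.
    rewrite count_mem_rempart mem_parts !count_mem_rowU //; lia.
  case: ifP => [c0|/negbT]; last first.
    by rewrite -eqn0Ngt => /eqP->; rewrite /= subr0 mulr1.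
  have -> : unionpart (rowpart k.+1) (rempart k.+1 l) = l.
    apply: intpart_count => i.
    rewrite count_mem_rowU // count_mem_rempart mem_parts; case: (eqVneq k.+1 i) => [<-|]; lia.
  rewrite count_mem_rempart mem_parts eqxx c0 -(prednK c0) /= subn1 /=; ring.
rewrite add0n; case: ifP => c0; last by rewrite subr0 mulr0.
have -> : rempart k.+1 (unionpart (rowpart j) l) =
          unionpart (rowpart j) (rempart k.+1 l).
  apply: intpart_count => i.
  rewrite count_mem_rempart mem_parts !count_mem_rowU // count_mem_rempart mem_parts.
  case: (eqVneq k.+1 i) => [<-|]; last lia.
  by rewrite (negbTE njk) /= add0n.
by rewrite count_mem_rempart eq_sym (negbTE njk) /= subn0 eqxx subrr.
Qed.

Lemma heis_comm (m n : int) f l : m != 0 -> n != 0 ->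
  heis m (heis n f) l - heis n (heis m f) l =
  if m + n == 0 then m%:~R * ((1 - q ^+ `|m|) / (1 - t ^+ `|m|)) * f l else 0.
Proof.
case: m n => [j|j] [k|k] j0 k0.
- rewrite heis_commPP ?subrr; [rewrite ifF //| |]; lia.
- rewrite heis_commPN; last lia.
  have -> : (Posz j + Negz k == 0) = (j == k.+1) by lia.
  by case: eqP.
- rewrite -opprB heis_commPN; last lia.
  have -> : (Negz j + Posz k == 0) = (k == j.+1) by lia.
  case: eqP => [->|]; last by rewrite oppr0.
  by rewrite NegzE mulrNz /= !mulNr.
- by rewrite heis_commNN subrr.
Qed.

(* <0| a_(-n) = 0 *)
Lemma heis_covacuum (n : nat) f : (0 < n)%N -> heis (- n%:Z) f nilpart = 0.
Proof. by case: n. Qed.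

(* |p_l> = a_(-l_1) ... a_(-l_r) |0> *)
Lemma ket_psum (l : intpart) :
  ket (<< l >> : Lambda R) =
  foldr (fun k w => heis (- k%:Z) w) vacuum (parts l).
Proof.
suff H s : all (leq 1) s -> foldr (fun k w => heis (- k%:Z) w) vacuum s =
   fun m : intpart => (perm_eq s m)%:R.
  rewrite H; last by case: l => s /= /andP[].
  apply/funext => m; rewrite /ket mcoeffU1; congr (nat_of_bool _)%:R.
  by apply/eqP/idP => [->//|/intpart_perm].
elim: s => [_|k s IH] /=.
  apply/funext => m; rewrite /vacuum; congr (nat_of_bool _)%:R.
  by apply/eqP/idP => [->//|h]; apply: intpart_perm; rewrite perm_sym.
case/andP; case: k => // k _ /IH ->; apply/funext => m /=.
case: ifP => km.
  by rewrite -(perm_cons k.+1) (permPr (perm_to_rem km)).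
case: (boolP (perm_eq _ _)) => // /perm_mem /(_ k.+1).
by rewrite inE eqxx km.
Qed.

Lemma heis_word (s : seq nat) (g : Fock R) (m : intpart) : all (leq 1) s ->
  exists2 u : intpart, perm_eq u (s ++ m) &
  (foldr (fun k w => heis k%:Z w) g s) m *
    (\prod_(k <- undup u) (count_mem k m)`!%:R) =
  (\prod_(k <- s) (k%:R * ((1 - q ^+ k) / (1 - t ^+ k)))) *
    (\prod_(k <- undup u) (count_mem k u)`!%:R) * g u.
Proof.
elim: s m => [|k s IH] m; first by exists m => //; rewrite big_nil mul1r mulrC.
rewrite [all _ _]/= => /andP[k0] /(IH (unionpart (rowpart k) m)) [u pu Hu].
have pu' : perm_eq u (k :: s ++ m).
  apply: (perm_trans pu); rewrite -cat1s perm_sym perm_catCA perm_cat2l.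
  by rewrite perm_sym (perm_trans (unionpart_perm _ _)) //= k0.
exists u => //; rewrite big_cons.
set c : R := k%:R * ((1 - q ^+ k) / (1 - t ^+ k)).
have rE (x y z : R) : c * x * y * z = c * (x * y * z) by rewrite !mulrA.
rewrite [RHS]rE -Hu.
set U := unionpart (rowpart k) m.
change (foldr (fun k w => heis k%:Z w) g (k :: s) m) with
  (c * (count_mem k U)%:R * foldr (fun k w => heis k%:Z w) g s U).
have ku : k \in undup u by rewrite mem_undup (perm_mem pu') inE eqxx.
rewrite !(big_rem k ku) /=.
have -> : \prod_(y <- rem k (undup u)) (count_mem y U)`!%:R
   = \prod_(y <- rem k (undup u)) (count_mem y m)`!%:R :> R.
  apply: eq_big_seq => y; rewrite /U (rem_filter _ (undup_uniq u)) mem_filter /=.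
  by case/andP => yk _; rewrite count_mem_rowU // eq_sym (negbTE yk).
rewrite count_mem_rowU // eqxx add1n factS natrM; ring.
Qed.

Lemma bra_ket (F G : Lambda R) : bra F (ket G) = form q t F G.
Proof.
rewrite /bra /form; apply: eq_bigr => l _; rewrite -mulrA; congr (_ * _).
have /(heis_word (ket G) nilpart) [u pu] : all (leq 1) l.
  by case: (l) => s /= /andP[].
have -> : u = l by apply: intpart_perm; rewrite (perm_trans pu) //= cats0.
rewrite big1 ?mulr1 // => ->; rewrite /ket mulrC; congr (_ * _).
rewrite /zqt big_split /= mulrAC; congr (_ * _).
rewrite mulrC -(prodr_undup_exp_count _ _ (fun k => k%:R)) mulrC -big_split /=.
by apply: eq_bigr => k _; rewrite natrM natrX mulrC.
Qed.

(* sum_k X_k f and exp(X) f, with coefficientwise convergent series *)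
Definition op_series (X : nat -> Fock R -> Fock R) f : Fock R :=
  fun l => limn (series (fun k => X k f l)).

Definition op_exp (X : Fock R -> Fock R) f : Fock R :=
  op_series (fun k w l => (k`!%:R)^-1 * iter k X w l) f.

Definition Gamma_exponent (sgn : bool) (rho : Lambda R -> R) : Fock R -> Fock R :=
  op_series (fun n f l => let k := n.+1 in
    (1 - t ^+ k) / (1 - q ^+ k) * (rho (psum k) / k%:R) *
    heis (if sgn then k%:Z else - k%:Z) f l).

Definition Gamma_plus (rho : Lambda R -> R) := op_exp (Gamma_exponent true rho).
Definition Gamma_minus (rho : Lambda R -> R) := op_exp (Gamma_exponent false rho).

(* v^D, the degree operator D being f |-> fun l => |l| f l *)
Definition pow_degree (v : R) f : Fock R := fun l => v ^+ weight l * f l.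

Definition transfer (gamma v : R) f : Fock R :=
  expR ((1 - t) / (1 - q) * gamma ^+ 2 * (v - 1)) *:
    Gamma_minus (plancherel (gamma * (1 - v)))
      (pow_degree v (Gamma_plus (plancherel (gamma * (1 - v))) f)).

Definition Tmatrix (P : intpart -> Lambda R) (gamma : R) l m (v : R) : R :=
  bra (P l) (transfer gamma v (ket (macdonaldQ q t P m))).

End FockSpace.

(** * The two processes *)

(* (a; u)_oo *)
Definition qpochhammer (R : realType) (a u : R) : R :=
  limn (fun n => \prod_(k < n) (1 - a * u ^+ k)).

(* The value sets of X are arbitrary: the partitions carry the discrete
   sigma-algebra.  Only b 0, ..., b n.+1 matter; ordS i is i + 1 modulo n + 1,
   which encodes l^(n+1) := l^0. *)
Definition periodic_macdonald_plancherel (R : realType) (q t gamma beta : R)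
    (P : intpart -> Lambda R) (d : measure_display) (Omega : measurableType d)
    (Pr : probability Omega R) (X : R -> Omega -> intpart) : Prop :=
  [/\ forall tau (A : set intpart), measurable (X tau @^-1` A),
      forall tau, {ae Pr, forall w, X (tau + beta) w = X tau w}
    & forall (n : nat) (b : nat -> R),
        b 0%N = 0 -> (forall i, (i <= n)%N -> b i < b i.+1) -> b n.+1 = beta ->
        forall l : {ffun 'I_n.+1 -> intpart},
        Pr [set w | forall i : 'I_n.+1, X (b i) w = l i] =
        (qpochhammer (expR (- beta)) (expR (- beta)) *
         \prod_(i < n.+1)
           Tmatrix q t P gamma (l i) (l (ordS i)) (expR (- (b i.+1 - b i))))%:E].

(* Unnormalized weights of the (n+1)-step periodic Macdonald process, with
   arguments l^1, ..., l^(n+1) stored as l 0, ..., l n (idem mu), rp i = rho^+_i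
   for i = 0, ..., n, and rm i = rho^-_(i+1).  The sum over mu has finite
   support, since a skew function l/m vanishes unless m is contained in l. *)
Definition periodic_macdonald_weight (R : realType) (q t u : R)
    (P : intpart -> Lambda R) (n : nat) (rp rm : 'I_n.+1 -> Lambda R -> R)
    (l : {ffun 'I_n.+1 -> intpart}) : R :=
  \sum_(mu \in [set: {ffun 'I_n.+1 -> intpart}])
    u ^+ weight (mu ord_max) *
    \prod_(i < n.+1)
      (rm i (skew (macdonaldQ q t P) (l i) (mu i)) *
       rp (ordS i) (skew P (l (ordS i)) (mu i))).

Definition periodic_macdonald (R : realType) (q t u : R)
    (P : intpart -> Lambda R) (n : nat) (rp rm : 'I_n.+1 -> Lambda R -> R)
    (l : {ffun 'I_n.+1 -> intpart}) : R :=
  periodic_macdonald_weight q t u P rp rm l /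
  fine (\esum_(k in [set: {ffun 'I_n.+1 -> intpart}])
          (periodic_macdonald_weight q t u P rp rm k)%:E).

(* Main.v *)
Require Import Defs.
From mathcomp Require Import all_boot all_order all_algebra finmap.
From mathcomp.multinomials Require Import monalg.
From mathcomp Require Import all_classical all_reals all_analysis.
From mathcomp Require Import ring zify.
Set Implicit Arguments.
Unset Strict Implicit.
Unset Printing Implicit Defensive.
Import Order.TTheory GRing.Theory Num.Theory.
Import numFieldNormedType.Exports.
Local Open Scope classical_set_scope.
Local Open Scope ring_scope.

(** The proof compares the two laws up to a positive factor and lets the total
    mass decide: the probabilities of the Plancherel process sum to 1, so if
    they are proportional to the weights of the periodic Macdonald process, the
    constant of proportionality is the inverse of the partition function, which
    never has to be evaluated ([esum_fibres]).

    Proportionality is seen in the power-sum basis.  Let F(rho_xi, Y) be the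
    image of F(X, Y) under a Plancherel specialization of X, and let
    [shift xi F m] be the coefficient of p_m(Y) in it.  The operator
    Gamma(rho_xi)_+ is the exponential of xi d/dp_1, that is, the substitution
    p_1 -> p_1 + xi, so it maps F to F(rho_xi, Y) ([Gamma_plus_shift]); the
    operator Gamma(rho_xi)_- is its adjoint for the (q,t)-form
    ([Gamma_adjoint]).  Hence, up to an explicit exponential, T_(l m)(v) is
       sum_k z_k v^|k| (shift P_l k) (shift Q_m k)      ([TmatrixE]).
    On the other side, for dual homogeneous bases B and C the skew function
    B_(l/j) is the pairing of B_l(X, Y) with C_j in the variables Y ([skewE]),
    and summing w^|j| C_(l/j)(rho) B_(k/j)(rho') over j uses the completeness
    relation of the bases to give the same kind of sum ([skew_sum]).

    The two sums differ in the following respects: the periodic process has Q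
    where T has P, and its specializations are those of T multiplied by
    exp(-b_i) and exp(b_(i+1)), the index being read cyclically; the degree in
    u corrects for the jump from beta back to 0.  By homogeneity ([shift_scale]) and the
    proportionality of P and Q this only changes the i-th factor by a ratio
    phi_i / phi_(i+1), and these ratios cancel around the cycle
    ([weight_prod]).

    Duality of the Macdonald functions requires that P_l be homogeneous of
    degree |l| and nonzero.  Their definition only gives the polynomials
    P_l(x_1, ..., x_n), so this rests on a triangularity of the power sums on
    monomials, for the order by length ([powersum_prod_supp]). *)

(** * Partitions of bounded weight *)

Lemma intpart_pos (l : intpart) : all (leq 1) l.
Proof. by case: l => s /= /andP[]. Qed.

Lemma weight_union l m : weight (unionpart l m) = (weight l + weight m)%N.
Proof.
by rewrite /weight (perm_sumn (unionpart_perm _ _)) sumn_cat.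
Qed.

Lemma weight_row k : weight (rowpart k) = k.
Proof. by case: k => //= k; rewrite /weight /= addn0. Qed.

Lemma rempart_row k l : (0 < k)%N -> rempart k (unionpart (rowpart k) l) = l.
Proof.
move=> k0; apply: intpart_count => i.
by rewrite count_mem_rempart mem_parts !count_mem_rowU //; lia.
Qed.

Lemma row_rempart k l : k \in parts l -> unionpart (rowpart k) (rempart k l) = l.
Proof.
move=> kl; have k0 : (0 < k)%N by apply: (allP (intpart_pos l)).
apply: intpart_count => i.
rewrite count_mem_rowU // count_mem_rempart kl andbT.
by move: kl; rewrite mem_parts; case: (eqVneq k i) => [<-|_]; lia.
Qed.

Lemma weight_rem k l : k \in parts l -> weight l = (k + weight (rempart k l))%N.
Proof. by move=> kl; rewrite -{1}(row_rempart kl) weight_union weight_row. Qed.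

Lemma row_eq k (l m : intpart) : (0 < k)%N ->
  (unionpart (rowpart k) l == m) = (k \in parts m) && (l == rempart k m).
Proof.
move=> k0; apply/eqP/andP => [<-|[km /eqP->]]; last exact: row_rempart.
by rewrite rempart_row // eqxx mem_parts count_mem_rowU // eqxx.
Qed.

Lemma size_le_sumn (s : seq nat) : all (leq 1) s -> (size s <= sumn s)%N.
Proof.
elim: s => //= k s IH /andP[k0 /IH h]; rewrite -add1n; exact: leq_add.
Qed.

Lemma mem_le_sumn (s : seq nat) k : k \in s -> (k <= sumn s)%N.
Proof.
elim: s => //= j s IH; rewrite inE => /orP[/eqP->|/IH h].
  exact: leq_addr.
exact: leq_trans h (leq_addl _ _).
Qed.

(** The parts and the multiplicities of a partition are at most its weight, so a
    partition of weight at most D is determined by a map from {0, ..., D} to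
    itself. *)
Lemma finite_weight_le D : finite_set [set l : intpart | (weight l <= D)%N].
Proof.
pose f (l : intpart) : {ffun 'I_D.+1 -> 'I_D.+1} :=
  [ffun k : 'I_D.+1 => inord (count_mem (k : nat) l)].
suff /inj_card_eq/eq_finite_set <- :
    set_inj [set l : intpart | (weight l <= D)%N] f by exact: finite_finset.
have cD (l : intpart) j : (weight l <= D)%N -> (count_mem j l < D.+1)%N.
  move=> lD; rewrite ltnS (leq_trans (count_size _ _)) //.
  exact: leq_trans (size_le_sumn (intpart_pos l)) lD.
move=> l m /set_mem/= lD /set_mem/= mD lm; apply: intpart_count => k.
have [kD|Dk] := ltnP k D.+1; last first.
  have out (l' : intpart) : (weight l' <= D)%N -> count_mem k l' = 0%N.
    move=> h; apply/eqP; rewrite eqn0Ngt -mem_parts; apply/negP => /mem_le_sumn h'.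
    by move: Dk; rewrite leqNgt ltnS (leq_trans h').
  by rewrite !out.
have := congr1 val (congr1 (fun g : {ffun _ -> _} => g (Ordinal kD)) lm).
by rewrite /= !ffunE /= !inordK ?cD.
Qed.

Definition parts_le (D : nat) : seq intpart :=
  fset_set [set l : intpart | (weight l <= D)%N].

Lemma parts_le_uniq D : uniq (parts_le D). Proof. exact: fset_uniq. Qed.

Lemma mem_parts_le D l : (l \in parts_le D) = (weight l <= D)%N.
Proof.
by rewrite /parts_le in_fset_set ?mem_setE //; exact: finite_weight_le.
Qed.

(** * Triangularity of the power sums on monomials *)

Lemma malg_mulUU (K : monomType) (R : nzRingType) (k1 k2 : K) :
  << k1 >> * << k2 >> = << mmul k1 k2 >> :> {malg R[K]}.
Proof. by have := @fgmulUU K R 1 1 k1 k2; rewrite mulr1. Qed.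

Section Exponents.
Variable n : nat.
Implicit Types (a : 'X_{1..n}).

(** As a multiset, the partition for which the monomial occurs in the monomial
    symmetric polynomial. *)
Definition exps a : seq nat := [seq e <- [seq a i | i <- enum 'I_n] | e != 0%N].

Definition pow_monom (i : 'I_n) (k : nat) : 'X_{1..n} :=
  iter k (mulcm (ucm i)) (onecm _).

Lemma pow_monomE i k j : pow_monom i k j = ((i == j) * k)%N.
Proof.
elim: k => [|k IH]; first by rewrite /pow_monom /= onecmE muln0.
by rewrite /pow_monom /= mulcmE ucmE -/(pow_monom i k) IH mulnS.
Qed.

Lemma mpolyX_pow (R : realType) i k :
  (<< ucm i >> : {mpoly R[n]}) ^+ k = << pow_monom i k >>.
Proof.
elim: k => [|k IH]; first by rewrite expr0.
rewrite exprS IH; exact: malg_mulUU.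
Qed.

Lemma exps_perm a i :
  perm_eq (exps a) ([seq e <- [:: a i] | e != 0%N] ++
    [seq e <- [seq a j | j <- rem i (enum 'I_n)] | e != 0%N]).
Proof.
rewrite /exps -filter_cat; apply: perm_filter.
by have /(perm_map (fun j => a j)) := perm_to_rem (mem_enum 'I_n i).
Qed.

Lemma exps_mul a i k :
  perm_eq (exps (mulcm (pow_monom i k) a))
    ([seq e <- [:: (k + a i)%N] | e != 0%N] ++
     [seq e <- [seq a j | j <- rem i (enum 'I_n)] | e != 0%N]).
Proof.
rewrite (permPl (exps_perm _ i)) mulcmE pow_monomE eqxx mul1n perm_cat2l.
suff -> : [seq mulcm (pow_monom i k) a j | j <- rem i (enum 'I_n)] =
          [seq a j | j <- rem i (enum 'I_n)] by [].
apply/eq_in_map => j; rewrite (rem_filter _ (enum_uniq _)) mem_filter /= eq_sym.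
by case/andP => /negbTE ij _; rewrite mulcmE pow_monomE ij.
Qed.

(** With [exps_mul_old], the dichotomy behind triangularity: a factor x_i^k
    creates an exponent k if x_i is absent, and otherwise leaves the number of
    exponents unchanged. *)
Lemma exps_mul_new a i k : (0 < k)%N -> a i = 0%N ->
  perm_eq (exps (mulcm (pow_monom i k) a)) (k :: exps a).
Proof.
move=> k0 ai; rewrite (permPl (exps_mul _ _ _)) ai addn0 /= -lt0n k0 perm_cons.
by rewrite perm_sym (permPl (exps_perm _ i)) ai.
Qed.

Lemma exps_mul_old a i k : a i != 0%N ->
  size (exps (mulcm (pow_monom i k) a)) = size (exps a).
Proof.
move=> ai; rewrite (perm_size (exps_mul _ _ _)) (perm_size (exps_perm a i)) /=.
by rewrite ai addn_eq0 negb_and ai orbT.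
Qed.

Lemma sumn_exps_mul a i k :
  sumn (exps (mulcm (pow_monom i k) a)) = (k + sumn (exps a))%N.
Proof.
have sf (s : seq nat) : sumn [seq e <- s | e != 0%N] = sumn s.
  by elim: s => //= x s IH; case: eqP => [->|_] /=; rewrite IH.
rewrite (perm_sumn (exps_mul _ _ _)) (perm_sumn (exps_perm a i)).
by rewrite !sumn_cat !sf /= !addn0 addnA.
Qed.

End Exponents.

Section MonomialProduct.
Context (K : monomType) (R : nzRingType).
Implicit Types (k m : K) (G : {malg R[K]}).

Lemma mcoeff_sum (I : Type) (r : seq I) (Q : pred I) (F : I -> {malg R[K]}) m :
  (\sum_(i <- r | Q i) F i)@_m = \sum_(i <- r | Q i) (F i)@_m.
Proof. by apply: (big_morph (mcoeff m) (mcoeffD m)); exact: mcoeff0. Qed.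

Lemma mcoeff_mulU k G m :
  (<< k >> * G)@_m = \sum_(j <- msupp G) G@_j *+ (mmul k j == m).
Proof.
have -> : << k >> * G = \sum_(j <- msupp G) << 1 * G@_j *g mmul k j >>.
  exact: fgmulUg.
by rewrite mcoeff_sum; apply: eq_bigr => j _; rewrite /= mcoeffU mul1r.
Qed.

Lemma mcoeff_mulU_cancel k G m : injective (mmul k) ->
  (<< k >> * G)@_(mmul k m) = G@_m.
Proof.
move=> kI; rewrite mcoeff_mulU [in RHS](monalgE G) mcoeff_sum /=.
by apply: eq_bigr => j _; rewrite mcoeffU (inj_eq kI).
Qed.

Lemma mcoeff_mulU_out k G m : (forall j, mmul k j != m) -> (<< k >> * G)@_m = 0.
Proof. by move=> h; rewrite mcoeff_mulU big1 // => j _; rewrite (negbTE (h j)). Qed.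

End MonomialProduct.

Section PowerSumMonomials.
Variables (R : realType) (n : nat).
Implicit Types (a : 'X_{1..n}) (s : seq nat).

Definition powersum_prod s : {mpoly R[n]} :=
  \prod_(k <- s) \sum_(i < n) << ucm i >> ^+ k.

Lemma mulcmI a : injective (mmul a).
Proof.
move=> b c /eqP/cmP h; apply/eqP/cmP => i; have := h i.
by rewrite !cmM => /addnI.
Qed.

Lemma powersum_prod_cons k s a :
  (powersum_prod (k :: s))@_a =
  \sum_(i < n) (<< pow_monom i k >> * powersum_prod s)@_a.
Proof.
have -> : powersum_prod (k :: s) =
    (\sum_(i < n) << pow_monom i k >>) * powersum_prod s.
  rewrite /powersum_prod big_cons; congr (_ * _); apply: eq_bigr => i _.
  exact: mpolyX_pow.
by rewrite mulr_suml mcoeff_sum.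
Qed.

Lemma powersum_prod_ge0 s a : 0 <= (powersum_prod s)@_a.
Proof.
elim: s a => [|k s IH] a; first by rewrite /powersum_prod big_nil mcoeff1; case: eqP.
rewrite powersum_prod_cons sumr_ge0 // => i _.
by rewrite mcoeff_mulU sumr_ge0 // => j _; rewrite mulrn_wge0.
Qed.

(** Expanding the product picks one x_i^k from each factor p_k; whenever a
    variable is picked twice, two parts merge and the number of exponents falls
    below the number of factors. *)
Lemma powersum_prod_supp s a : all (leq 1) s -> (powersum_prod s)@_a != 0 ->
  sumn (exps a) = sumn s /\ ((size (exps a) < size s)%N \/ perm_eq (exps a) s).
Proof.
elim: s a => [|k s IH] a /=.
  rewrite /powersum_prod big_nil mcoeff1.
  case: (eqVneq a (@mone 'X_{1..n})) => [->|_ _]; last first.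
    by rewrite eqxx.
  have -> : exps (@mone 'X_{1..n}) = [::].
    rewrite /exps (@eq_map _ _ _ (fun=> 0%N)); last by move=> i; rewrite cm1.
    by elim: (enum _).
  by move=> _ _; split => //; right.
case/andP => k0 s0; rewrite powersum_prod_cons => h.
have [i hi] : exists i, (<< pow_monom i k >> * powersum_prod s)@_a != 0.
  apply: contrapT => /forallNP no; case/eqP: h; rewrite big1 // => i _.
  by apply/eqP/negPn/negP; exact: no.
(* The monomial a comes from x_i^k times a monomial b of the shorter product. *)
have [b ba hb] : exists2 b, mulcm (pow_monom i k) b = a & (powersum_prod s)@_b != 0.
  apply: contrapT => no; case/eqP: hi; rewrite mcoeff_mulU big1_seq // => j /= js.
  case: eqP => // ja; exfalso; apply: no; exists j => //; by rewrite mcoeff_neq0.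
have [sb cb] := IH b s0 hb.
rewrite -ba sumn_exps_mul sb; split => //.
have [bi|bi] := eqVneq (b i) 0%N; last first.
  by left; rewrite exps_mul_old // ltnS; case: cb => [/ltnW//|/perm_size->].
have pk := exps_mul_new k0 bi.
case: cb => cb; first by left; rewrite (perm_size pk).
by right; rewrite (permPl pk) perm_cons.
Qed.

(** No cancellation can occur, as all coefficients are nonnegative; a single
    contribution suffices, and picking x_i^k from a factor p_k, at a variable
    whose exponent is k, supplies it. *)
Lemma powersum_prod_gt0 s a : all (leq 1) s -> perm_eq (exps a) s ->
  0 < (powersum_prod s)@_a.
Proof.
elim: s a => [|k s IH] a /=.
  move=> _ /perm_nilP as0; have -> : a = @mone 'X_{1..n}.
    apply/eqP/cmP => i; rewrite cm1; apply/eqP; apply: contraT => ai.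
    suff : a i \in exps a by rewrite as0.
    by rewrite mem_filter ai /=; apply: map_f; rewrite mem_enum.
  by rewrite /powersum_prod big_nil mcoeff1 eqxx.
case/andP => k0 s0 ps.
have : k \in exps a by rewrite (perm_mem ps) inE eqxx.
rewrite mem_filter => /andP[_ /mapP[i _ ki]].
pose b := divcm a (pow_monom i k).
have bi : b i = 0%N by rewrite divcmE pow_monomE eqxx mul1n -ki subnn.
have ab : a = mulcm (pow_monom i k) b.
  apply/eqP/cmP => j; rewrite mulcmE divcmE pow_monomE.
  by case: eqVneq => [<-|_]; rewrite ?mul1n ?mul0n -?ki ?subn0 // addnBA ?subnn // addKn.
have pb : perm_eq (exps b) s.
  by rewrite -(perm_cons k) -(permPl (exps_mul_new k0 bi)) -ab.
rewrite powersum_prod_cons (bigD1 i) //= ltr_wpDr //.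
  rewrite sumr_ge0 // => j _; rewrite mcoeff_mulU sumr_ge0 // => c _.
  by rewrite mulrn_wge0 // powersum_prod_ge0.
rewrite {1}ab mcoeff_mulU_cancel; [exact: IH|exact: mulcmI].
Qed.

Lemma mcoeff_invars (F : Lambda R) a :
  (invars n F)@_a = \sum_(m <- msupp F) F@_m * (powersum_prod m)@_a.
Proof. 
rewrite /invars /psum_morph mmapE mcoeff_sum; apply: eq_bigr => m _.
exact: mcoeffCM.
Qed.

Lemma mcoeff_monsym_neq0 l a : (monsym n l : {mpoly R[n]})@_a != 0 ->
  perm_eq (exps a) l.
Proof.
apply: contraR => na; apply/eqP; rewrite /monsym mcoeff_sum big1_seq // => b /= hb.
rewrite mcoeffU1; case: eqP => // ba; move: hb na; rewrite ba.
case: finite_supportP => // X XP _ _ aX.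
by move: (XP a aX) => ->.
Qed.

(** Sums over an infinite support are 0 by convention, so this finiteness is what
    gives monomial symmetric polynomials their coefficients 1. *)
Lemma finite_exps (l : intpart) : finite_set [set a : 'X_{1..n} | perm_eq (exps a) l].
Proof.
pose f (a : 'X_{1..n}) : {ffun 'I_n -> 'I_(weight l).+1} :=
  [ffun i => inord (a i)].
suff /inj_card_eq/eq_finite_set <- :
    set_inj [set a : 'X_{1..n} | perm_eq (exps a) l] f by exact: finite_finset.
have le (a : 'X_{1..n}) i : perm_eq (exps a) l -> (a i < (weight l).+1)%N.
  move=> h; rewrite ltnS; have [->//|ai] := eqVneq (a i) 0%N.
  apply: mem_le_sumn; rewrite -(perm_mem h) mem_filter ai /=.
  by apply: map_f; rewrite mem_enum.
move=> a b /set_mem/= ha /set_mem/= hb ab; apply/eqP/cmP => i.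
have := congr1 val (congr1 (fun g : {ffun _ -> _} => g i) ab).
by rewrite /= !ffunE /= !inordK ?le.
Qed.

Lemma mcoeff_monsym (l : intpart) a : perm_eq (exps a) l ->
  (monsym n l : {mpoly R[n]})@_a = 1.
Proof.
move=> al; rewrite /monsym fsbig_finite; last exact: finite_exps.
have aX : a \in fset_set [set a : 'X_{1..n} | perm_eq (exps a) l].
  by rewrite in_fset_set ?mem_setE //; exact: finite_exps.
rewrite mcoeff_sum (eq_bigr (fun b => (b == a)%:R)); last first.
  by move=> b _; exact: mcoeffU1.
rewrite (big_rem a aX) /= eqxx big1_seq ?addr0 // => b /=.
by rewrite (rem_filter _ (fset_uniq _)) mem_filter /= => /andP[/negbTE->].
Qed.

End PowerSumMonomials.

Lemma exps_nth (l : intpart) :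
  exists a : 'X_{1..size l}, exps a = l.
Proof.
pose a : 'X_{1..size l} := [cmonom nth 0%N l i | i in [fset j | j in 'I_(size l)]%fset]%M.
exists a; have aE i : a i = nth 0%N l i by rewrite cmE fsfunE !inE.
rewrite /exps; have -> : [seq a i | i <- enum 'I_(size l)] = l.
  apply: (@eq_from_nth _ 0%N); first by rewrite size_map size_enum_ord.
  move=> i; rewrite size_map size_enum_ord => il.
  rewrite (nth_map (Ordinal il)) ?size_enum_ord // aE.
  by rewrite (nth_enum_ord (Ordinal il) il).
by apply/all_filterP; have := intpart_pos l; under eq_all do rewrite lt0n.
Qed.

(** * Homogeneity of the Macdonald functions *)

Lemma max_seq (T : eqType) (f : T -> nat) (s : seq T) (x : T) : x \in s ->
  exists2 y, y \in s & forall z, z \in s -> (f z <= f y)%N.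
Proof.
elim: s x => // x s IH _ _; case: s IH => [_|y s IH].
  by exists x; rewrite ?inE // => z; rewrite inE => /eqP->.
have [|w ws wm] := IH y; first by rewrite mem_head.
have [h|h] := leqP (f w) (f x).
  exists x; rewrite ?mem_head // => z; rewrite inE => /orP[/eqP->//|/wm zw].
  exact: leq_trans h.
exists w; first by rewrite inE ws orbT.
by move=> z; rewrite inE => /orP[/eqP->|/wm//]; exact: ltnW.
Qed.

Section MacdonaldSupport.
Context {R : realType}.
Variables (q t : R) (P : intpart -> Lambda R).
Hypothesis hP : is_macdonald q t P.

Lemma macdonald_invars_supp l n (a : 'X_{1..n}) :
  (invars n (P l))@_a != 0 -> sumn (exps a) = weight l.
Proof.
case: hP => -[c /(_ l n) ->] _; rewrite mcoeffD => h.
have {h} [/eqP h|/eqP h] : (monsym n l)@_a <> 0 :> R \/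
    (\sum_(m \in [set m | dominated m l && (m != l)]) c l m *: monsym n m)@_a <> 0.
  by apply/not_andP => -[h1 h2]; rewrite h1 h2 addr0 eqxx in h.
  by rewrite (perm_sumn (mcoeff_monsym_neq0 h)).
apply: contraNeq h => h; rewrite mcoeff_sum big1_seq // => m /=.
case: finite_supportP => // X XA _ _ /XA/= /andP[/andP[/eqP mw _] _].
rewrite mcoeffZ; have [->|/mcoeff_monsym_neq0/perm_sumn e] :=
  eqVneq ((monsym n m)@_a) (0 : R); first by rewrite mulr0.
by move: h; rewrite e -mw /weight eqxx.
Qed.

(** Take a longest mu among the partitions of the wrong weight that occur in P l.
    In [size mu] variables, a power sum contributing to x^mu has the weight of
    mu and is mu or longer, so it is p_mu; but x^mu does not occur in P l. *)
Lemma macdonald_weight l m : m \in msupp (P l) -> weight m = weight l.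
Proof.
move=> ml; apply/eqP; apply: contraT => mw.
pose S := [seq k <- msupp (P l) | weight k != weight l].
have [|mu muS mumax] := @max_seq _ (fun k : intpart => size k) S m.
  by rewrite mem_filter mw ml.
move: muS; rewrite mem_filter => /andP[muw mul].
have [a aE] := exps_nth mu.
have : (invars (size mu) (P l))@_a == 0.
  by apply: contraNT muw => /macdonald_invars_supp <-; rewrite aE.
rewrite mcoeff_invars (big_rem mu) //= big1_seq => [|k].
  rewrite addr0 mulf_eq0 mcoeff_eq0 mul /=.
  by rewrite gt_eqF // powersum_prod_gt0 ?aE // intpart_pos.
rewrite (rem_filter _ (fset_uniq _)) mem_filter /= => /andP[kmu kl].
apply/eqP; rewrite mulf_eq0; apply/orP; right; apply: contraT => /powersum_prod_supp.
rewrite aE => /(_ (intpart_pos k)) [kw kc].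
have kS : k \in S by rewrite mem_filter kl /weight -kw -/(weight mu) muw.
case: kc => [|/intpart_perm e]; last by rewrite e eqxx in kmu.
by rewrite ltnNge mumax.
Qed.

(** The monomial x^l occurs with coefficient 1, as dominance excludes l itself
    from the lower terms. *)
Lemma macdonald_neq0 l : P l != 0.
Proof.
apply/eqP => Pl0; have [a aE] := exps_nth l.
case: (hP) => -[c /(_ l (size l))] /(congr1 (mcoeff a)) + _.
rewrite Pl0 /invars raddf0 mcoeff0 mcoeffD mcoeff_monsym; last by rewrite aE.
rewrite mcoeff_sum big1_seq ?addr0; first by move/eqP; rewrite eq_sym oner_eq0.
move=> m /=; case: finite_supportP => // X XA _ _ /XA/= /andP[_ ml].
rewrite mcoeffZ; have [->|/mcoeff_monsym_neq0] :=
  eqVneq ((monsym (size l) m)@_a) (0 : R); first by rewrite mulr0.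
by rewrite aE => /intpart_perm e; rewrite e eqxx in ml.
Qed.

End MacdonaldSupport.

(** * Dual homogeneous bases and completeness *)

Section DualBases.
Context {R : realType}.
Variables (q t : R).
Hypotheses (hq : 0 < q < 1) (ht : 0 < t < 1).
Implicit Types (F G : Lambda R) (l m k : intpart) (B C : intpart -> Lambda R).

Lemma ratio_gt0 (k : nat) : (0 < k)%N -> 0 < (1 - q ^+ k) / (1 - t ^+ k).
Proof.
case/andP: hq => q0 q1; case/andP: ht => t0 t1 k0.
by rewrite divr_gt0 // subr_gt0 exprn_ilt1 ?ltW // -lt0n.
Qed.

Lemma zqt_gt0 l : 0 < zqt q t l.
Proof.
rewrite /zqt mulr_gt0 // big_seq prodr_gt0 // => k; rewrite ?mem_undup => kl.
  rewrite ltr0n muln_gt0 fact_gt0 expn_gt0; apply/orP; left.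
  exact: (allP (intpart_pos l)).
by apply: ratio_gt0; exact: (allP (intpart_pos l)).
Qed.

Definition bounded_by D (f : intpart -> R) : Prop :=
  forall l, (D < weight l)%N -> f l = 0.

Lemma form_parts_le D F G : bounded_by D (fun l => F@_l) ->
  Defs.form q t F G = \sum_(l <- parts_le D) F@_l * G@_l * zqt q t l.
Proof.
move=> FD; rewrite /Defs.form; apply: big_fset_incl => [|l _ /mcoeff_outdom->].
  apply/fsubsetP => l; rewrite -mcoeff_neq0 => Fl.
  have := mem_parts_le D l; rewrite /parts_le => ->.
  by rewrite leqNgt; apply: contra Fl => /FD ->.
by rewrite !mul0r.
Qed.

Lemma formZr a F G : Defs.form q t F (a *: G) = a * Defs.form q t F G.
Proof.
by rewrite /Defs.form mulr_sumr; apply: eq_bigr => l _; rewrite mcoeffZ; ring.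
Qed.

Lemma form_gt0 F : F != 0 -> 0 < Defs.form q t F F.
Proof.
move=> F0; rewrite lt_neqAle; apply/andP; split; last first.
  apply: sumr_ge0 => l _; apply: mulr_ge0; last exact/ltW/zqt_gt0.
  by rewrite -expr2 sqr_ge0.
move: F0; apply: contraNneq => /esym/eqP.
rewrite psumr_eq0 => [/allP h|l _].
  apply/eqP/malgP => l; rewrite mcoeff0; apply/eqP; rewrite mcoeff_eq0.
  apply/negP => lF; have Fl : F@_l != 0 by rewrite mcoeff_neq0.
  have := h l lF; apply/negP.
  exact: mulf_neq0 (mulf_neq0 Fl Fl) (lt0r_neq0 (zqt_gt0 l)).
apply: mulr_ge0; last exact/ltW/zqt_gt0.
by rewrite -expr2 sqr_ge0.
Qed.

Definition homogeneous_family B : Prop :=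
  forall l m, m \in msupp (B l) -> weight m = weight l.

Definition dual_bases B C : Prop :=
  [/\ homogeneous_family B, homogeneous_family C
    & forall l m, Defs.form q t (B l) (C m) = (l == m)%:R].

Lemma homogeneous_bounded B l D : homogeneous_family B -> (weight l <= D)%N ->
  bounded_by D (fun m => (B l)@_m).
Proof.
move=> hB lD m mD; apply/eqP; rewrite mcoeff_eq0; apply/negP => /hB h.
by move: mD; rewrite h ltnNge lD.
Qed.

Lemma dual_bases_sym B C : dual_bases B C -> dual_bases C B.
Proof.
move=> [hB hC BC]; split => // l m; rewrite eq_sym -BC.
pose D := maxn (weight l) (weight m).
rewrite !(@form_parts_le D); first by apply: eq_bigr => k _; ring.
  by apply: homogeneous_bounded; rewrite ?leq_maxr.
by apply: homogeneous_bounded; rewrite ?leq_maxl.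
Qed.

(** On the partitions of weight at most D, duality says that the matrix of B is
    left inverse to the transpose of that of C weighted by z.  For square
    matrices the inverse is two-sided, which is this identity. *)
Lemma dual_completeness B C D m k : dual_bases B C ->
  (weight m <= D)%N -> (weight k <= D)%N ->
  \sum_(l <- parts_le D) zqt q t m * (C l)@_m * (B l)@_k = (m == k)%:R.
Proof.
move=> [hB hC BC] mD kD; pose s := in_tuple (parts_le D).
pose M := \matrix_(i < size (parts_le D), j < size (parts_le D))
            (B (tnth s i))@_(tnth s j).
pose W := \matrix_(j < size (parts_le D), i < size (parts_le D))
            (zqt q t (tnth s j) * (C (tnth s i))@_(tnth s j)).
have sD i : (weight (tnth s i) <= D)%N.
  by rewrite -mem_parts_le; exact: mem_tnth.
have sI : injective (tnth s) by apply/tuple_uniqP; exact: parts_le_uniq.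
have MW : M *m W = 1%:M.
  apply/matrixP => i i'; rewrite !mxE -(inj_eq sI) -BC.
  rewrite (@form_parts_le D); last exact: homogeneous_bounded.
  rewrite [RHS]big_tnth.
  by apply: eq_bigr => j _; rewrite !mxE; ring.
have at_ l : (weight l <= D)%N -> exists i, l = tnth s i.
  by rewrite -mem_parts_le => /(tnthP s).
have [[i ->] [j ->]] := (at_ m mD, at_ k kD).
have := congr1 (fun A => fun_of_matrix A i j) (mulmx1C MW).
rewrite !mxE (inj_eq sI) => <-; rewrite [LHS]big_tnth.
by apply: eq_bigr => l _; rewrite !mxE.
Qed.

Lemma macdonald_dual P : is_macdonald q t P ->
  dual_bases P (macdonaldQ q t P).
Proof.
move=> hP; split=> [l m|l m|l m].
- exact: (macdonald_weight hP).
- rewrite -mcoeff_neq0 mcoeffZ mulf_eq0 negb_or mcoeff_neq0 => /andP[_].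
  exact: (macdonald_weight hP).
- rewrite formZr; have [->|lm] := eqVneq l m.
    by rewrite mulVf // gt_eqF // form_gt0 // (macdonald_neq0 hP).
  by case: hP => _ /(_ _ _ lm)->; rewrite mulr0.
Qed.

End DualBases.

(** * Coefficients of F(X, Y) *)

Lemma mul_rowI k : (0 < k)%N -> injective (unionpart (rowpart k)).
Proof. by move=> k0; apply: (can_inj (g := rempart k)) => l; exact: rempart_row. Qed.

Lemma mcoeff_row_mul (S : nzRingType) k (G : {malg S[intpart]}) m : (0 < k)%N ->
  (<< rowpart k >> * G)@_m = if k \in parts m then G@_(rempart k m) else 0.
Proof.
move=> k0; case: ifP => km.
  rewrite -{1}(row_rempart km); apply: mcoeff_mulU_cancel; exact: mul_rowI.
by apply: mcoeff_mulU_out => j; rewrite (row_eq _ _ k0) km.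
Qed.

Section Coproduct.
Context {R : realType}.
Implicit Types (F G : Lambda R) (l m : intpart) (s : seq nat).

(** A product of p_k(X) + p_k(Y) over a word rather than a partition, so that
    inductions can remove its first letter. *)
Definition inXY_word s : Lambda2 := \prod_(k <- s) (inX (psum k : Lambda R) + inY (psum k)).

Lemma inY_psum k : (0 < k)%N -> inY (psum k : Lambda R) = << rowpart k >>.
Proof. by move=> k0; rewrite /inY psum_morph_psum. Qed.

Lemma mcoeff_inXY_nil m : (inXY_word [::])@_m = (m == nilpart)%:R.
Proof. by rewrite /inXY_word big_nil mcoeff1. Qed.

Lemma mcoeff_inXY_cons k s m : (0 < k)%N ->
  (inXY_word (k :: s))@_m = psum k * (inXY_word s)@_m +
    if k \in parts m then (inXY_word s)@_(rempart k m) else 0.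
Proof.
move=> k0; have -> : inXY_word (k :: s) =
    (psum k : Lambda R)%:MP * inXY_word s + << rowpart k >> * inXY_word s.
  by rewrite /inXY_word big_cons mulrDl inY_psum.
rewrite mcoeffD; congr (_ + _); first exact: mcoeffCM.
exact: mcoeff_row_mul.
Qed.

Lemma mcoeff_inXY F m :
  (inXY F)@_m = \sum_(l <- msupp F) F@_l *: (inXY_word l)@_m.
Proof.
rewrite /inXY /psum_morph mmapE mcoeff_sum; apply: eq_bigr => l _.
rewrite [LHS]mcoeffCM; exact: mul_malgC.
Qed.

(** The products of the p_k(Y) over partitions are the monomial basis of the
    functions of X and Y over the functions of X. *)
Lemma mcoeff_inX_inY F G m : (inX F * inY G)@_m = G@_m *: F.
Proof.
have wordE (l : intpart) : psum_prod (fun k => << rowpart k >> : @Lambda2 R) l = << l >>.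
  rewrite /psum_prod.
  suff H s : all (leq 1) s -> forall j : intpart, perm_eq s j ->
      \prod_(k <- s) (<< rowpart k >> : @Lambda2 R) = << j >>.
    by apply: H => //; exact: intpart_pos.
  elim: s => [|i s IH] /=.
    move=> _ j jn; have -> : j = nilpart by apply: intpart_perm; rewrite perm_sym.
    by rewrite big_nil.
  case/andP => i0 /IH {}IH j ij; rewrite big_cons.
  have ji : i \in parts j by rewrite -(perm_mem ij) mem_head.
  rewrite (IH (rempart i j)); last first.
    by rewrite -(perm_cons i) (permPl ij) perm_to_rem.
  transitivity (<< unionpart (rowpart i) (rempart i j) >> : @Lambda2 R).
    exact: malg_mulUU.
  by rewrite row_rempart.
transitivity (F * (inY G)@_m); first exact: mcoeffCM.
rewrite /inY /psum_morph mmapE mcoeff_sum [in RHS](monalgE G) mcoeff_sum.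
rewrite scaler_suml mulr_sumr; apply: eq_bigr => l _.
rewrite wordE; transitivity (F * ((G@_l)%:MP * (<< l >> : @Lambda2 R)@_m)).
  by congr (_ * _); exact: mcoeffCM.
rewrite mcoeffU1 mcoeffU; case: eqP => _; last by rewrite !mulr0 scale0r.
by rewrite mulr1 mulrC; exact: mul_malgC.
Qed.

End Coproduct.

(** * Plancherel shifts *)

Section PlancherelShift.
Context {R : realType}.
Implicit Types (F G : Lambda R) (l m : intpart) (s : seq nat) (xi a : R).

Lemma plancherelD xi : {morph plancherel xi : F G / F + G}.
Proof. by move=> F G; rewrite /plancherel raddfD. Qed.

Lemma plancherel0 xi : plancherel xi 0 = 0.
Proof. exact: raddf0. Qed.

Lemma plancherelM xi : {morph plancherel xi : F G / F * G}.
Proof. by move=> F G; rewrite /plancherel rmorphM. Qed.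

Lemma plancherelZ xi a F : plancherel xi (a *: F) = a * plancherel xi F.
Proof.
have -> : a *: F = a%:MP * F by apply/esym; exact: mul_malgC.
by rewrite plancherelM /plancherel psum_morphC.
Qed.

Lemma plancherel_sum xi (I : Type) (r : seq I) (F : I -> Lambda R) :
  plancherel xi (\sum_(i <- r) F i) = \sum_(i <- r) plancherel xi (F i).
Proof. exact: (big_morph _ (plancherelD xi) (plancherel0 xi)). Qed.

Lemma plancherel_psum xi k : (0 < k)%N ->
  plancherel xi (psum k) = if k == 1%N then xi else 0.
Proof. by move=> k0; rewrite /plancherel psum_morph_psum. Qed.

Definition word_shift xi s m : R := plancherel xi (inXY_word s)@_m.

(** The coefficient of p_m(Y) in F(rho_xi, Y). *)
Definition shift xi F m : R := plancherel xi (inXY F)@_m.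

Lemma shiftE xi F m :
  shift xi F m = \sum_(l <- msupp F) F@_l * word_shift xi l m.
Proof.
rewrite /shift mcoeff_inXY plancherel_sum; apply: eq_bigr => l _.
exact: plancherelZ.
Qed.

Lemma word_shift_nil xi m : word_shift xi [::] m = (m == nilpart)%:R.
Proof.
rewrite /word_shift mcoeff_inXY_nil; case: eqP => _; last exact: plancherel0.
by rewrite /plancherel rmorph1.
Qed.

Lemma word_shift_cons xi k s m : (0 < k)%N ->
  word_shift xi (k :: s) m =
    (if k == 1%N then xi else 0) * word_shift xi s m +
    if k \in parts m then word_shift xi s (rempart k m) else 0.
Proof.
move=> k0; rewrite /word_shift mcoeff_inXY_cons // plancherelD plancherelM.
rewrite plancherel_psum //; congr (_ + _); case: ifP => // _; exact: plancherel0.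
Qed.

Lemma word_shift0 s m : all (leq 1) s -> word_shift 0 s m = (perm_eq s m)%:R.
Proof.
elim: s m => [|k s IH] m /=.
  move=> _; rewrite word_shift_nil; congr (nat_of_bool _)%:R.
  by apply/eqP/idP => [->//|h]; apply: intpart_perm; rewrite perm_sym.
case/andP => k0 s0; rewrite word_shift_cons // if_same mul0r add0r.
case: ifP => km.
  by rewrite IH // -(perm_cons k) -(permPr (perm_to_rem km)).
by case: (boolP (perm_eq _ _)) => // /perm_mem /(_ k); rewrite mem_head km.
Qed.

(** Specializing X to nothing recovers F from F(X, Y); in particular F(X, Y) is
    nonzero when F is. *)
Lemma shift0 F m : shift 0 F m = F@_m.
Proof.
rewrite shiftE [in RHS](monalgE F) mcoeff_sum; apply: eq_bigr => l _.
rewrite word_shift0 ?intpart_pos // mcoeffU -[RHS]mulr_natr; congr (_ * (nat_of_bool _)%:R).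
by apply/idP/eqP => [/intpart_perm//|->].
Qed.

Lemma inXY_word_bounded s m : all (leq 1) s -> (sumn s < weight m)%N ->
  (inXY_word s)@_m = 0 :> Lambda R.
Proof.
elim: s m => [|k s IH] m /=.
  by rewrite mcoeff_inXY_nil; case: eqP => // ->.
case/andP => k0 s0 sm; rewrite mcoeff_inXY_cons // IH //; last lia.
rewrite mulr0 add0r; case: ifP => // km; apply: IH => //.
by rewrite (weight_rem km) ltn_add2l in sm.
Qed.

Lemma inXY_bounded F D m : bounded_by D (fun l => F@_l) -> (D < weight m)%N ->
  (inXY F)@_m = 0.
Proof.
move=> FD Dm; rewrite mcoeff_inXY big1_seq // => l /= lF.
rewrite inXY_word_bounded ?scaler0 ?intpart_pos //.
apply: leq_trans Dm; rewrite ltnS leqNgt; apply/negP => /FD/eqP.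
by rewrite mcoeff_eq0 lF.
Qed.

Lemma word_shift_scale a xi s m : all (leq 1) s ->
  a ^+ weight m * word_shift (a * xi) s m = a ^+ sumn s * word_shift xi s m.
Proof.
elim: s m => [|k s IH] m /=.
  rewrite !word_shift_nil; case: eqP => [->|_]; last by rewrite !mulr0.
  by rewrite /weight.
case/andP => k0 s0; rewrite !word_shift_cons // !mulrDr exprD; congr (_ + _).
  case: eqP => [->|_]; last by rewrite !mul0r !mulr0.
  by rewrite mulrCA IH // expr1; ring.
case: ifP => km; last by rewrite !mulr0.
by rewrite (weight_rem km) exprD -!mulrA IH.
Qed.

(** F(a rho, a Y) = a^d F(rho, Y) for F homogeneous of degree d. *)
Lemma shift_scale a xi F d m : (forall l, l \in msupp F -> weight l = d) ->
  a ^+ weight m * shift (a * xi) F m = a ^+ d * shift xi F m.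
Proof.
move=> Fd; rewrite !shiftE !mulr_sumr; apply: eq_big_seq => l /= lF.
by rewrite mulrCA word_shift_scale ?intpart_pos // -/(weight l) (Fd l lF) mulrCA.
Qed.

Lemma shiftZ xi a F m : shift xi (a *: F) m = a * shift xi F m.
Proof.
have [->|a0] := eqVneq a 0.
  rewrite scale0r mul0r /shift /inXY.
  by rewrite raddf0 mcoeff0 plancherel0.
rewrite !shiftE mulr_sumr msuppZ (negbTE a0); apply: eq_bigr => l _.
by rewrite mcoeffZ mulrA.
Qed.

End PlancherelShift.

(** * Skew functions of dual bases *)

Section Skew.
Context {R : realType}.
Variables (q t : R).
Implicit Types (F G : Lambda R) (l m j : intpart).
Variables B C : intpart -> Lambda R.
Hypothesis BC : dual_bases q t B C.
Let hB : homogeneous_family B. Proof. by case: BC. Qed.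
Let hC : homogeneous_family C. Proof. by case: BC. Qed.

Lemma mcoeff_homog l m : weight l != weight m -> (B l)@_m = 0.
Proof.
move=> lm; apply/eqP; rewrite mcoeff_eq0; apply: contra lm => /hB ->; exact: eqxx.
Qed.

Lemma dual_pairing l j D : (weight j <= D)%N ->
  \sum_(m <- parts_le D) zqt q t m * (C j)@_m * (B l)@_m = (l == j)%:R.
Proof.
move=> jD; have [_ _ CB] := dual_bases_sym BC.
rewrite eq_sym -CB (@form_parts_le _ _ _ D); last exact: homogeneous_bounded.
by apply: eq_bigr => m _; ring.
Qed.

Lemma dual_neq0 l : B l != 0.
Proof.
apply/eqP => Bl; have [_ _ /(_ l l)] := BC.
rewrite Bl /Defs.form msupp0 big_nil eqxx => /eqP.
by rewrite eq_sym oner_eq0.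
Qed.

(** Pairing B l(X, Y) with C j in the variables Y isolates the coefficient of
    B j.  An infinite support would make the sum 0, hence B l = 0. *)
Lemma skew_unique l (S : intpart -> Lambda R) j D : (weight j <= D)%N ->
  inXY (B l) = \sum_(k \in [set: intpart]) inX (S k) * inY (B k) ->
  S j = \sum_(m <- parts_le D) (zqt q t m * (C j)@_m) *: (inXY (B l))@_m.
Proof.
move=> jD; case: finite_supportP => [_|X _ Xout _ ->].
  rewrite big_nil => Bl0; case/eqP: (dual_neq0 l); apply/malgP => m.
  by rewrite -shift0 /shift Bl0 mcoeff0 plancherel0 mcoeff0.
transitivity (\sum_(k <- X) (k == j)%:R *: S k).
  have [jX|jX] := boolP (j \in X).
    rewrite (big_rem j jX) /= eqxx scale1r big1_seq ?addr0 // => k /=.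
    rewrite (rem_filter _ (fset_uniq _)) mem_filter /= => /andP[/negbTE-> _].
    exact: scale0r.
  rewrite big1_seq => [|k /= kX]; last first.
    by case: eqP => [kj|_]; [rewrite -kj kX in jX|exact: scale0r].
  have Sj : forall m, (B j)@_m *: S j = 0.
    move=> m; rewrite -mcoeff_inX_inY; apply/eqP; rewrite mcoeff_eq0.
    by rewrite (Xout j) // msupp0.
  have -> : S j = (\sum_(m <- parts_le D) zqt q t m * (C j)@_m * (B j)@_m) *: S j.
    by rewrite dual_pairing // eqxx scale1r.
  rewrite scaler_suml big1 // => m _.
  by rewrite -scalerA Sj scaler0.
rewrite [RHS](eq_bigr (fun m => \sum_(k <- X)
    (zqt q t m * (C j)@_m * (B k)@_m) *: S k)); last first.
  move=> m _; rewrite mcoeff_sum scaler_sumr; apply: eq_bigr => k _.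
  by rewrite mcoeff_inX_inY scalerA.
rewrite exchange_big /=; apply: eq_bigr => k _.
by rewrite -scaler_suml dual_pairing.
Qed.

(** The coefficients found by pairing reproduce B l(X, Y) by completeness.  They
    are cut off beyond the weight of l, where only zeros would be added, to make
    the finiteness of the support evident. *)
Lemma skew_exists l : exists S : intpart -> Lambda R,
  inXY (B l) = \sum_(k \in [set: intpart]) inX (S k) * inY (B k).
Proof.
pose D := weight l.
pose S k := if (weight k <= D)%N then
  \sum_(m <- parts_le D) (zqt q t m * (C k)@_m) *: (inXY (B l))@_m else 0.
suff E : inXY (B l) = \sum_(k <- parts_le D) inX (S k) * inY (B k).
  exists S; rewrite E; apply/esym/fsbigTE => k.
  have := mem_parts_le D k; rewrite /parts_le => -> /negbTE h.
  by rewrite /S h /inX monalgU0 mul0r.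
apply/malgP => m; rewrite [RHS]mcoeff_sum.
rewrite [RHS](eq_big_seq (fun k => \sum_(i <- parts_le D)
    (zqt q t i * (C k)@_i * (B k)@_m) *: (inXY (B l))@_i)); last first.
  move=> k /=; rewrite mem_parts_le mcoeff_inX_inY /S => ->.
  rewrite scaler_sumr; apply: eq_bigr => i _; rewrite scalerA; congr (_ *: _).
  exact: mulrC.
rewrite [RHS]exchange_big /=; have [mD|Dm] := leqP (weight m) D; last first.
  rewrite (@inXY_bounded _ _ D) //; last exact: homogeneous_bounded.
  rewrite big1 // => i _; rewrite big1_seq // => k /=; rewrite mem_parts_le => kD.
  rewrite mcoeff_homog ?mulr0 ?scale0r //.
  by rewrite neq_ltn (leq_ltn_trans kD Dm).
have mP : m \in parts_le D by rewrite mem_parts_le.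
rewrite [RHS](eq_big_seq (fun i => (i == m)%:R *: (inXY (B l))@_i)); last first.
  by move=> i /=; rewrite mem_parts_le => iD; rewrite -scaler_suml dual_completeness.
rewrite [RHS](big_rem m mP) /= eqxx scale1r big1_seq ?addr0 // => k /=.
rewrite (rem_filter _ (parts_le_uniq _)) mem_filter /= => /andP[/negbTE-> _].
exact: scale0r.
Qed.

Lemma skewE l j D : (weight j <= D)%N ->
  Defs.skew B l j = \sum_(m <- parts_le D) (zqt q t m * (C j)@_m) *: (inXY (B l))@_m.
Proof.
move=> jD; apply: (skew_unique jD).
exact: (@xgetPex _ (fun=> 0) [set S : intpart -> Lambda R |
    inXY (B l) = \sum_(m \in [set: intpart]) inX (S m) * inY (B m)] (skew_exists l)).
Qed.

Lemma skew_eq0 l j : (weight l < weight j)%N -> Defs.skew B l j = 0.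
Proof.
move=> lj; rewrite (skewE _ (leqnn _)) big1 // => m _.
have [mj|mj] := eqVneq (weight m) (weight j).
  rewrite (@inXY_bounded _ _ (weight l)) ?scaler0 ?mj //.
  exact: homogeneous_bounded.
suff -> : (C j)@_m = 0 by rewrite mulr0 scale0r.
apply/eqP; rewrite mcoeff_eq0; apply: contra mj => /hC ->; exact: eqxx.
Qed.

Lemma plancherel_skew xi l j D : (weight j <= D)%N ->
  plancherel xi (Defs.skew B l j) =
  \sum_(m <- parts_le D) zqt q t m * (C j)@_m * shift xi (B l) m.
Proof.
move=> jD; rewrite (skewE l jD) plancherel_sum; apply: eq_bigr => m _.
exact: plancherelZ.
Qed.

End Skew.

Section SkewSum.
Context {R : realType}.
Variables (q t : R) (B C : intpart -> Lambda R).
Hypothesis BC : dual_bases q t B C.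

(** Both skew functions are pairings; since B j is homogeneous, w^|j| becomes
    w^|m|, and the remaining sum over j is the completeness relation. *)
Lemma skew_sum w xi1 xi2 (l k : intpart) D :
  \sum_(j <- parts_le D)
     w ^+ weight j * (plancherel xi1 (Defs.skew C l j) * plancherel xi2 (Defs.skew B k j)) =
  \sum_(m <- parts_le D)
     zqt q t m * w ^+ weight m * shift xi1 (C l) m * shift xi2 (B k) m.
Proof.
have prod_sum (v : R) (f1 f2 : intpart -> R) :
    v * ((\sum_(m <- parts_le D) f1 m) * \sum_(i <- parts_le D) f2 i) =
    \sum_(m <- parts_le D) \sum_(i <- parts_le D) v * (f1 m * f2 i).
  rewrite mulr_suml mulr_sumr; apply: eq_bigr => m _.
  by rewrite !mulr_sumr.
have alg (v a b c d e g : R) :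
    v * (a * b * c * (d * e * g)) = d * e * b * (a * v * c * g) by ring.
pose f m i j := zqt q t i * (C j)@_i * (B j)@_m *
  (zqt q t m * w ^+ weight m * shift xi1 (C l) m * shift xi2 (B k) i).
transitivity (\sum_(j <- parts_le D) \sum_(m <- parts_le D)
    \sum_(i <- parts_le D) f m i j).
  apply: eq_big_seq => j /=; rewrite mem_parts_le => jD.
  rewrite (plancherel_skew (dual_bases_sym BC) _ _ jD) (plancherel_skew BC _ _ jD).
  rewrite prod_sum; apply: eq_bigr => m _; apply: eq_bigr => i _; rewrite /f.
  have [mj|mj] := eqVneq (weight m) (weight j); last first.
    have -> : (B j)@_m = 0 by apply: (mcoeff_homog BC); rewrite eq_sym.
    by rewrite !(mulr0, mul0r).
  by rewrite mj; exact: alg.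
rewrite exchange_big /=; apply: eq_big_seq => m /=; rewrite mem_parts_le => mD.
rewrite exchange_big /=.
rewrite (eq_big_seq (fun i => (i == m)%:R *
  (zqt q t m * w ^+ weight m * shift xi1 (C l) m * shift xi2 (B k) i))); last first.
  move=> i /=; rewrite mem_parts_le => iD.
  by rewrite -mulr_suml (dual_completeness BC).
have mP : m \in parts_le D by rewrite mem_parts_le.
rewrite (big_rem m mP) /= eqxx mul1r big1_seq ?addr0 // => i /=.
rewrite (rem_filter _ (parts_le_uniq _)) mem_filter /= => /andP[/negbTE-> _].
exact: mul0r.
Qed.

End SkewSum.

(** * Half-vertex operators of Plancherel specializations *)

Lemma lim_series_finite (R : realType) (u : nat -> R) N :
  (forall n, (N <= n)%N -> u n = 0) -> limn (series u) = \sum_(k < N) u k.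
Proof.
move=> u0; apply: cvg_lim => //; apply: cvg_near_cst; near=> n.
have Nn : (N <= n)%N by near: n; exact: nbhs_infty_ge.
have tail : \sum_(N <= i < n) u i = 0 by rewrite big_nat big1 // => i /andP[/u0].
by rewrite /series /= (big_cat_nat (leq0n N) Nn) /= tail addr0 big_mkord.
Unshelve. all: by end_near. Qed.

Section VertexOperators.
Context {R : realType}.
Variables (q t : R).
Implicit Types (F G : Lambda R) (l m : intpart) (f : Fock R) (xi : R).

(** xi d/dp_1, acting on coefficients in the power-sum basis. *)
Definition lower xi f : Fock R := fun l =>
  xi * (count_mem 1%N (unionpart (rowpart 1) l))%:R * f (unionpart (rowpart 1) l).

(** Multiplication by xi (1 - t) / (1 - q) p_1, acting on coefficients. *)
Definition raise xi f : Fock R := fun l =>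
  (1 - t) / (1 - q) * xi * if 1%N \in parts l then f (rempart 1 l) else 0.

Definition trunc_exp (A : Fock R -> Fock R) (K : nat) f : Fock R :=
  fun l => \sum_(k < K) (k`!%:R)^-1 * iter k A f l.

Lemma lower_bounded xi f D : bounded_by D f -> bounded_by D (lower xi f).
Proof.
by move=> fD l lD; rewrite /lower fD ?mulr0 // weight_union weight_row ltnW.
Qed.

Lemma iter_lower_bounded xi f D k l : bounded_by D f -> (D < weight l + k)%N ->
  iter k (lower xi) f l = 0.
Proof.
elim: k l => [|k IH] l fD h; first by apply: fD; rewrite addn0 in h.
rewrite iterS /lower IH ?mulr0 // weight_union weight_row; lia.
Qed.

Lemma iter_raise_eq0 xi f k l : (weight l < k)%N -> iter k (raise xi) f l = 0.
Proof.
elim: k l => // k IH l h; rewrite iterS /raise; case: ifP => l1; last by rewrite mulr0.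
by rewrite IH ?mulr0 //; move: h; rewrite (weight_rem l1); lia.
Qed.

Hypotheses (hq : 0 < q < 1) (ht : 0 < t < 1).

Let q1 : 1 - q != 0. Proof. by case/andP: hq => _ h; rewrite subr_eq0 gt_eqF. Qed.
Let t1 : 1 - t != 0. Proof. by case/andP: ht => _ h; rewrite subr_eq0 gt_eqF. Qed.

(** A Plancherel specialization kills all p_n with n > 1, so only the mode of
    degree 1 survives in the exponent. *)
Lemma Gamma_exponent_lower xi :
  Gamma_exponent q t true (plancherel xi) = lower xi.
Proof.
apply/funext => f; apply/funext => l; rewrite /Gamma_exponent /op_series.
rewrite (@lim_series_finite _ _ 1) => [|[//|n] _].
  rewrite big_ord1 /= plancherel_psum // eqxx !expr1 /lower /=.
  by field; rewrite q1 t1.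
by rewrite plancherel_psum // mul0r mulr0 mul0r.
Qed.

Lemma Gamma_exponent_raise xi :
  Gamma_exponent q t false (plancherel xi) = raise xi.
Proof.
apply/funext => f; apply/funext => l; rewrite /Gamma_exponent /op_series.
rewrite (@lim_series_finite _ _ 1) => [|[//|n] _].
  by rewrite big_ord1 plancherel_psum // !expr1 /raise divr1.
by rewrite plancherel_psum // mul0r mulr0 mul0r.
Qed.

Lemma Gamma_plus_trunc xi f D K l : bounded_by D f -> (D < K)%N ->
  Gamma_plus q t (plancherel xi) f l = trunc_exp (lower xi) K f l.
Proof.
move=> fD DK; rewrite /Gamma_plus Gamma_exponent_lower /op_exp /op_series.
apply: lim_series_finite => n Kn.
by rewrite (iter_lower_bounded _ fD) ?mulr0 //; lia.
Qed.

Lemma Gamma_minus_trunc xi f K l : (weight l < K)%N ->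
  Gamma_minus q t (plancherel xi) f l = trunc_exp (raise xi) K f l.
Proof.
move=> lK; rewrite /Gamma_minus Gamma_exponent_raise /op_exp /op_series.
by apply: lim_series_finite => n Kn; rewrite iter_raise_eq0 ?mulr0 //; lia.
Qed.

Lemma zqt_row1 l :
  zqt q t (unionpart (rowpart 1) l) * ((1 - t) / (1 - q)) =
  zqt q t l * (count_mem 1%N (unionpart (rowpart 1) l))%:R.
Proof.
have undupE N (s : seq nat) (g : nat -> nat -> R) : all (fun k => k < N)%N s ->
    (forall k, g k 0%N = 1) ->
    \prod_(k <- undup s) g k (count_mem k s) = \prod_(k <- iota 0 N) g k (count_mem k s).
  move=> sN g1; rewrite [RHS](bigID (mem s)) /= [X in _ * X]big1 ?mulr1; last first.
    by move=> k /count_memPn->.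
  rewrite -[RHS]big_filter; apply: perm_big; apply: uniq_perm.
  - exact: undup_uniq.
  - by rewrite filter_uniq // iota_uniq.
  - move=> k; rewrite mem_undup mem_filter mem_iota /= add0n andbC.
    by case: (boolP (k \in s)) => [/(allP sN)->|]; rewrite ?andbF.
pose g k c : R := (c`! * k ^ c)%N%:R.
have cU k := @count_mem_rowU k 1 l isT; have pU := unionpart_perm (rowpart 1) l.
move: (unionpart _ _) cU pU => U cU pU.
have [N N1 [UN lN]] : exists2 N, (1 < N)%N &
    all (fun k => k < N)%N U /\ all (fun k => k < N)%N l.
  exists (weight U).+2 => //; split; apply/allP => k /mem_le_sumn h.
    by rewrite ltnS; apply: leqW.
  by rewrite /weight (perm_sumn pU) /=; lia.
rewrite /zqt (undupE N U g) // (undupE N l g) //.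
have oneN : 1%N \in iota 0 N by rewrite mem_iota.
rewrite (big_rem 1%N oneN) [X in _ = X * _ * _](big_rem 1%N oneN) /=.
rewrite (eq_big_seq (fun k => g k (count_mem k l))) => [|k]; last first.
  rewrite (rem_filter _ (iota_uniq _ _)) mem_filter /= => /andP[k1 _].
  by rewrite cU eq_sym (negbTE k1).
rewrite (perm_big _ pU) big_cons cU eqxx add1n /g !exp1n !muln1 factS natrM !expr1.
rewrite /=; by field; rewrite q1 t1.
Qed.

(** Reindexing by l = (1) U m, the factor z_l / z_m produces the multiplicity
    that d/dp_1 brings down ([zqt_row1]). *)
Lemma raise_adjoint xi f g D : bounded_by D f ->
  \sum_(l <- parts_le D) zqt q t l * f l * raise xi g l =
  \sum_(l <- parts_le D) zqt q t l * lower xi f l * g l.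
Proof.
move=> fD; pose S := [seq l <- parts_le D | 1%N \in parts l].
pose T := [seq l <- parts_le D | (weight l < D)%N].
transitivity (\sum_(l <- S) zqt q t l * f l *
    ((1 - t) / (1 - q) * xi * g (rempart 1 l))).
  rewrite big_filter [RHS]big_mkcond; apply: eq_bigr => l _; rewrite /raise.
  by case: ifP => _; rewrite ?mulr0.
transitivity (\sum_(l <- T) zqt q t l * lower xi f l * g l); last first.
  rewrite big_filter big_mkcond; apply: eq_bigr => l _; case: ifPn => //.
  rewrite -leqNgt => Dl; rewrite /lower fD ?mulr0 ?mul0r // weight_union weight_row.
  by rewrite add1n ltnS.
rewrite (perm_big (map (unionpart (rowpart 1)) T)) /=.
  rewrite big_map; apply: eq_bigr => l _; rewrite rempart_row // /lower.
  rewrite mulrCA; have := zqt_row1 l.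
  set z1 := zqt q t (unionpart _ _); set z := zqt q t l; set c := count_mem _ _.
  set f1 := f _ => e.
  transitivity (z1 * ((1 - t) / (1 - q)) * (f1 * xi * g l)); first by ring.
  by rewrite e; ring.
apply: uniq_perm; first by rewrite filter_uniq // parts_le_uniq.
  by rewrite map_inj_uniq ?filter_uniq ?parts_le_uniq //; exact: mul_rowI.
move=> l; rewrite mem_filter mem_parts_le; apply/andP/mapP => [[l1 lD]|[m]].
  exists (rempart 1 l); last by rewrite row_rempart.
  by rewrite mem_filter mem_parts_le; move: lD; rewrite (weight_rem l1); lia.
rewrite mem_filter mem_parts_le => /andP[mD _] ->.
by rewrite mem_parts count_mem_rowU // weight_union weight_row.
Qed.

Lemma iter_raise_adjoint xi k f g D : bounded_by D f ->
  \sum_(l <- parts_le D) zqt q t l * f l * iter k (raise xi) g l =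
  \sum_(l <- parts_le D) zqt q t l * iter k (lower xi) f l * g l.
Proof.
elim: k f => // k IH f fD; rewrite iterS raise_adjoint // IH; last exact: lower_bounded.
by rewrite -iterSr.
Qed.

(** The exponents are adjoint, and on partitions of weight at most D both
    exponential series are finite sums. *)
Lemma Gamma_adjoint xi f g D : bounded_by D f ->
  \sum_(l <- parts_le D) zqt q t l * f l * Gamma_minus q t (plancherel xi) g l =
  \sum_(l <- parts_le D) zqt q t l * Gamma_plus q t (plancherel xi) f l * g l.
Proof.
move=> fD.
transitivity (\sum_(k < D.+1) (k`!%:R)^-1 *
  \sum_(l <- parts_le D) zqt q t l * f l * iter k (raise xi) g l).
  under [RHS]eq_bigr do rewrite mulr_sumr.
  rewrite exchange_big /=; apply: eq_big_seq => l; rewrite mem_parts_le => lD.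
  rewrite (@Gamma_minus_trunc _ _ D.+1) // /trunc_exp mulr_sumr.
  by apply: eq_bigr => k _; rewrite mulrCA.
under eq_bigr do rewrite iter_raise_adjoint // mulr_sumr.
rewrite exchange_big /=; apply: eq_bigr => l _.
rewrite (@Gamma_plus_trunc _ _ D D.+1) // /trunc_exp mulr_sumr mulr_suml.
by apply: eq_bigr => k _; rewrite [in RHS]mulrCA !mulrA.
Qed.

End VertexOperators.

(** * The transition matrix *)

Section TransferMatrix.
Context {R : realType}.
Variables (q t : R).
Hypotheses (hq : 0 < q < 1) (ht : 0 < t < 1).
Implicit Types (F G : Lambda R) (l m : intpart) (f g : Fock R) (xi : R).

Definition add_part (k : nat) f : Fock R := fun l =>
  if k \in parts l then f (rempart k l) else 0.

Let q1 : 1 - q != 0. Proof. by case/andP: hq => _ h; rewrite subr_eq0 gt_eqF. Qed.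
Let t1 : 1 - t != 0. Proof. by case/andP: ht => _ h; rewrite subr_eq0 gt_eqF. Qed.

(** The Heisenberg relation, read as [d/dp_1, p_k] = delta_(k,1). *)
Lemma lower_add_part xi k f l : (0 < k)%N ->
  lower xi (add_part k f) l =
  add_part k (lower xi f) l + (if k == 1%N then xi else 0) * f l.
Proof.
case: k => // k _; have := @heis_commPN R q t 1 k f l isT.
have lowerE g m : lower xi g m = xi * ((1 - t) / (1 - q)) * heis q t (Posz 1) g m.
  by rewrite /lower /heis !expr1; field; rewrite q1 t1.
have addE g m : add_part k.+1 g m = heis q t (Negz k) g m by [].
have -> : add_part k.+1 (lower xi f) l =
    xi * ((1 - t) / (1 - q)) * heis q t (Negz k) (heis q t (Posz 1) f) l.
  by rewrite /add_part /= ; case: ifP => _; rewrite ?mulr0 // lowerE.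
rewrite lowerE => /eqP; rewrite subr_eq => /eqP ->.
rewrite mulrDr addrC; congr (_ + _); rewrite eq_sym.
case: eqP => _; last by rewrite mulr0 mul0r.
by rewrite !expr1; field; rewrite q1 t1.
Qed.

(** Powers of [lower] read f at one partition only, which makes them commute with
    finite sums. *)
Lemma iter_lower_eval xi k l : exists c u, forall f,
  iter k (lower xi) f l = c * f u.
Proof.
elim: k l => [|k IH] l; first by exists 1, l => f; rewrite mul1r.
have [c [u cu]] := IH (unionpart (rowpart 1) l).
by eexists; exists u => f; rewrite iterS /lower cu mulrA.
Qed.

Lemma iter_lower_add_part xi k f j l : (0 < k)%N ->
  iter j (lower xi) (add_part k f) l =
  add_part k (iter j (lower xi) f) l +
  j%:R * (if k == 1%N then xi else 0) * iter j.-1 (lower xi) f l.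
Proof.
move=> k0; elim: j l => [|j IH] l; first by rewrite !mul0r addr0.
set d := if _ then _ else _ in IH *.
rewrite iterS; have -> : iter j (lower xi) (add_part k f) =
    fun m => add_part k (iter j (lower xi) f) m + j%:R * d * iter j.-1 (lower xi) f m.
  by apply/funext => m; rewrite IH.
transitivity (lower xi (add_part k (iter j (lower xi) f)) l +
    j%:R * d * lower xi (iter j.-1 (lower xi) f) l).
  by rewrite /lower; ring.
rewrite lower_add_part // -addrA; congr (_ + _); rewrite -/d.
case: j {IH} => [|j]; first by rewrite /= !mul0r addr0 mul1r.
by rewrite -[j.+2%:R]natr1 /=; ring.
Qed.

(** Gamma_+ a_(-k) = (a_(-k) + p_k(rho)) Gamma_+.  The commutator uses up one
    lowering step, hence the shorter truncation in the last term. *)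
Lemma trunc_exp_add_part xi k f K l : (0 < k)%N ->
  trunc_exp (lower xi) K.+1 (add_part k f) l =
  add_part k (trunc_exp (lower xi) K.+1 f) l +
  (if k == 1%N then xi else 0) * trunc_exp (lower xi) K f l.
Proof.
move=> k0; rewrite /trunc_exp.
under eq_bigr do rewrite iter_lower_add_part // mulrDr.
rewrite big_split /=; congr (_ + _).
  rewrite /add_part; case: ifP => _ //.
  by rewrite big1 // => i _; rewrite mulr0.
rewrite big_ord_recl /= !mul0r mulr0 add0r mulr_sumr; apply: eq_bigr => i _.
rewrite /bump /= add1n /= factS natrM.
have : (i.+1)%:R != 0 :> R by rewrite pnatr_eq0.
have : (i`!)%:R != 0 :> R by rewrite pnatr_eq0 -lt0n fact_gt0.
move: (i`!%:R) (i.+1%:R) => x y x0 y0.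
by field; rewrite x0 y0.
Qed.

Lemma trunc_exp_word xi (s : seq nat) K l : all (leq 1) s -> (sumn s < K)%N ->
  trunc_exp (lower xi) K (fun m => (perm_eq s m)%:R) l = word_shift xi s l.
Proof.
elim: s K l => [|k s IH] K l /=.
  move=> _ K0; rewrite word_shift_nil.
  have nilb : bounded_by 0 (fun m : intpart => (perm_eq [::] m)%:R : R).
    move=> m m0; case: (boolP (perm_eq _ _)) => // /perm_sumn e.
    by move: m0; rewrite /weight -e.
  case: K K0 => // K _; rewrite /trunc_exp big_ord_recl big1 ?addr0.
    rewrite invr1 mul1r; congr (nat_of_bool _)%:R.
    by apply/idP/eqP => [h|->//]; apply: intpart_perm; rewrite perm_sym.
  by move=> i _; rewrite lift0 (iter_lower_bounded _ nilb) ?mulr0 ?addnS.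
case/andP => k0 s0; case: K => // K sK.
have -> : (fun m : intpart => (perm_eq (k :: s) m)%:R) =
    add_part k (fun m => (perm_eq s m)%:R) :> Fock R.
  apply/funext => m; rewrite /add_part; case: ifP => km.
    by rewrite (permPr (perm_to_rem km)) perm_cons.
  by case: (boolP (perm_eq _ _)) => // /perm_mem /(_ k); rewrite mem_head km.
rewrite trunc_exp_add_part // word_shift_cons // addrC; congr (_ + _).
  case: eqP => [k1|_]; last by rewrite !mul0r.
  by congr (_ * _); apply: IH => //; lia.
by rewrite /add_part; case: ifP => // _; apply: IH => //; lia.
Qed.

(** On power sums both sides satisfy the recursion of [word_shift_cons], by
    [trunc_exp_add_part]; linearity does the rest. *)
Lemma Gamma_plus_shift xi F D l : bounded_by D (fun m => F@_m) ->
  Gamma_plus q t (plancherel xi) (ket F) l = shift xi F l.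
Proof.
move=> FD; rewrite (Gamma_plus_trunc hq ht xi l FD (ltnSn D)) shiftE.
transitivity (\sum_(k <- msupp F)
    F@_k * trunc_exp (lower xi) D.+1 (fun m => (perm_eq k m)%:R) l); last first.
  apply: eq_big_seq => k kF; rewrite trunc_exp_word ?intpart_pos // ltnS leqNgt.
  by apply/negP => /FD/eqP; rewrite mcoeff_eq0 kF.
rewrite /trunc_exp; under [RHS]eq_bigr do rewrite mulr_sumr.
rewrite exchange_big /=; apply: eq_bigr => j _.
have [c [u cu]] := iter_lower_eval xi j l; rewrite cu.
under eq_bigr do rewrite cu.
rewrite /ket (monalgE F) mcoeff_sum !mulr_sumr -(monalgE F).
apply: eq_bigr => k _; rewrite mcoeffU -mulr_natr.
have -> : (k == u) = perm_eq k u by apply/eqP/idP => [->//|/intpart_perm].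
by ring.
Qed.

(** The pairing of a bra with an arbitrary formal combination: Gamma_- leaves the
    Fock space of finite ones. *)
Lemma braE F f : bra q t F f = \sum_(l <- msupp F) F@_l * (zqt q t l * f l).
Proof.
rewrite /bra; apply: eq_bigr => l _; congr (_ * _).
have /(heis_word q t f nilpart) [u pu] := intpart_pos l.
have -> : u = l by apply: intpart_perm; rewrite (perm_trans pu) //= cats0.
rewrite big1 ?mulr1 // => ->; congr (_ * _).
rewrite /zqt big_split /= mulrAC; congr (_ * _).
rewrite mulrC -(prodr_undup_exp_count _ _ (fun k => k%:R)) mulrC -big_split /=.
by apply: eq_bigr => k _; rewrite natrM natrX mulrC.
Qed.

(** Once Gamma_- is moved to the left vector, both vertex operators act as
    shifts. *)
Lemma TmatrixE P gamma l m v D : dual_bases q t P (macdonaldQ q t P) ->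
  (weight l <= D)%N -> (weight m <= D)%N ->
  Tmatrix q t P gamma l m v =
  expR ((1 - t) / (1 - q) * gamma ^+ 2 * (v - 1)) *
  \sum_(k <- parts_le D) zqt q t k * v ^+ weight k *
    shift (gamma * (1 - v)) (P l) k *
    shift (gamma * (1 - v)) (macdonaldQ q t P m) k.
Proof.
move=> [hP hQ _] lD mD; rewrite /Tmatrix /transfer.
have PD := homogeneous_bounded hP lD.
have QD := homogeneous_bounded hQ mD.
set xi := gamma * (1 - v); set e := expR _; pose rho := plancherel xi.
set h := pow_degree v (Gamma_plus q t rho (ket (macdonaldQ q t P m))).
transitivity (e * \sum_(k <- parts_le D)
    zqt q t k * ket (P l) k * Gamma_minus q t rho h k).
  rewrite -/rho -/h braE mulr_sumr.
  transitivity (\sum_(k <- msupp (P l)) e * (zqt q t k * ket (P l) k * Gamma_minus q t rho h k)).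
    apply: eq_bigr => k _; rewrite /ket.
    have -> : (e *: Gamma_minus q t rho h) k = e * Gamma_minus q t rho h k by [].
    by ring.
  apply: big_fset_incl => [|k _ /mcoeff_outdom k0]; last first.
    by rewrite /ket k0 mulr0 mul0r mulr0.
  apply/fsubsetP => k; rewrite -mcoeff_neq0 => kP.
  have := mem_parts_le D k; rewrite /parts_le => ->.
  by rewrite leqNgt; apply: contra kP => /PD ->.
congr (_ * _); rewrite (Gamma_adjoint hq ht _ _ PD); apply: eq_bigr => k _.
rewrite /h /pow_degree (Gamma_plus_shift _ _ PD) (Gamma_plus_shift _ _ QD).
exact: etrans (mulrACA _ _ _ _) (mulrA _ _ _).
Qed.

End TransferMatrix.

(** * The weight of the periodic process *)

Lemma fsum_ffun_prod (R : comNzRingType) (I : finType) (T : choiceType)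
    (s : seq T) (F : I -> T -> R) : uniq s ->
    (forall i x, x \notin s -> F i x = 0) ->
  \sum_(f \in [set: {ffun I -> T}]) \prod_i F i (f i) =
  \prod_i \sum_(x <- s) F i x.
Proof.
move=> us F0; pose t := tnth (in_tuple s).
have tI : injective t by apply/tuple_uniqP.
pose h (g : {ffun I -> 'I_(size s)}) : {ffun I -> T} := [ffun i => t (g i)].
have hI : injective h.
  move=> g1 g2 /ffunP e; apply/ffunP => i; apply: tI.
  by have := e i; rewrite !ffunE.
transitivity (\prod_i \sum_(j < size s) F i (t j)); last first.
  by apply: eq_bigr => i _; rewrite [RHS]big_tnth.
rewrite bigA_distr_bigA /=.
rewrite (fsbigE [seq h g | g : {ffun I -> 'I_(size s)}]) //; first last.
- move=> f _ fh; apply/eqP/negPn/negP => nz; case/negP: fh.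
  have fs i : exists j, f i = t j.
    apply/(tnthP (in_tuple s)); apply: contraT => /(F0 i) e.
    by move: nz; rewrite (bigD1 i) //= e mul0r eqxx.
  have [g gE] := choice fs; apply/mapP; exists [ffun i => g i].
    by rewrite mem_enum.
  by apply/ffunP => i; rewrite !ffunE.
- by rewrite map_inj_uniq // enum_uniq.
rewrite big_map big_enum_cond /=; apply: eq_big => [g|g _].
  by rewrite in_setT.
by apply: eq_bigr => i _; rewrite ffunE.
Qed.

Lemma prod_cyclic_ratio (R : fieldType) n (phi : 'I_n.+1 -> R) :
  (forall i, phi i != 0) -> \prod_(i < n.+1) (phi i / phi (ordS i)) = 1.
Proof.
move=> phi0; rewrite prodf_div.
rewrite [X in _ / X](_ : _ = \prod_(i < n.+1) phi i).
  by rewrite divff //; apply/prodf_neq0.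
rewrite [RHS](reindex (@ordS n.+1)) //; exists (@ord_pred n.+1) => i _.
  exact: ordSK.
exact: ord_predK.
Qed.

Section Weight.
Context {R : realType}.
Variables (q t : R).
Hypotheses (hq : 0 < q < 1) (ht : 0 < t < 1).
Variable P : intpart -> Lambda R.
Hypothesis hP : is_macdonald q t P.
Let Q := macdonaldQ q t P.
Let PQ : dual_bases q t P Q. Proof. exact: macdonald_dual. Qed.
Let normP l : R := Defs.form q t (P l) (P l).
Let normP0 l : normP l != 0.
Proof. by rewrite gt_eqF // form_gt0 // (macdonald_neq0 hP). Qed.

(** The factor that a site contributes to the ratio of the two weights: replacing
    Q by P gives the norm, rescaling the specialization gives the power of a. *)
Definition potential (a : R) l : R := a ^+ weight l / Defs.form q t (P l) (P l).

Lemma potential_neq0 a l : a != 0 -> potential a l != 0.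
Proof. by move=> a0; rewrite mulf_neq0 ?expf_neq0 ?invr_eq0 // normP0. Qed.

(** The powers of a and a' left over from the two applications of homogeneity
    combine with w into v. *)
Lemma skew_factor (w gamma a a' v : R) l k D :
  a != 0 -> a' != 0 -> v = w / a * a' ->
  (weight l <= D)%N -> (weight k <= D)%N ->
  \sum_(j <- parts_le D) w ^+ weight j *
    (plancherel (a * (gamma * (1 - v))) (Defs.skew Q l j) *
     plancherel (a'^-1 * (gamma * (1 - v))) (Defs.skew P k j)) =
  potential a l / potential a' k *
  ((expR ((1 - t) / (1 - q) * gamma ^+ 2 * (v - 1)))^-1 * Tmatrix q t P gamma l k v).
Proof.
move=> a0 a0' vE lD kD; rewrite (skew_sum PQ) (TmatrixE hq ht _ _ PQ lD kD).
rewrite mulKf ?gt_eqF ?expR_gt0 //.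
move: (gamma * (1 - v)) => xi; rewrite mulr_sumr; apply: eq_bigr => m _.
have [Ph Qh _] := PQ.
have Ql : forall l0 x, shift x (Q l0) m = (normP l0)^-1 * shift x (P l0) m.
  by move=> l0 x; exact: shiftZ.
have s1 := shift_scale a xi m (Ph l).
have s2 := shift_scale a'^-1 xi m (Ph k).
rewrite -/Q !Ql /potential -/(normP l) -/(normP k).
move: s1 s2 (normP0 l) (normP0 k); move: (normP l) (normP k) => nl nk.
move: (shift (a * xi) (P l) m) (shift (a'^-1 * xi) (P k) m) => x1 x2.
move: (shift xi (P l) m) (shift xi (P k) m) (zqt q t m) => y1 y2 z e1 e2 nl0 nk0.
have am0 : a ^+ weight m != 0 by rewrite expf_neq0.
have am0' : a' ^+ weight m != 0 by rewrite expf_neq0.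
have ak0' : a' ^+ weight k != 0 by rewrite expf_neq0.
have -> : x1 = (a ^+ weight m)^-1 * (a ^+ weight l * y1) by rewrite -e1 mulKf.
have -> : x2 = a' ^+ weight m * ((a' ^+ weight k)^-1 * y2).
  by rewrite -exprVn -e2 exprVn mulVKf.
rewrite vE !exprMn exprVn.
by field; rewrite am0 nl0 nk0 ak0'.
Qed.

(** The sum over mu factors into one sum for each site, and the potentials
    telescope around the cycle. *)
Lemma weight_prod (gamma u : R) n (a v : 'I_n.+1 -> R)
    (rp rm : 'I_n.+1 -> Lambda R -> R) (l : {ffun 'I_n.+1 -> intpart}) :
  (forall i, a i != 0) ->
  (forall i, v i = (if i == ord_max then u else 1) / a i * a (ordS i)) ->
  (forall i, rm i = plancherel (a i * (gamma * (1 - v i)))) ->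
  (forall i, rp (ordS i) = plancherel ((a (ordS i))^-1 * (gamma * (1 - v i)))) ->
  periodic_macdonald_weight q t u P rp rm l =
  (\prod_(i < n.+1) expR ((1 - t) / (1 - q) * gamma ^+ 2 * (v i - 1)))^-1 *
  \prod_(i < n.+1) Tmatrix q t P gamma (l i) (l (ordS i)) (v i).
Proof.
move=> a0 vE rmE rpE; rewrite /periodic_macdonald_weight -/Q.
pose D := \max_(i < n.+1) weight (l i).
have lD i : (weight (l i) <= D)%N by exact: leq_bigmax.
pose w (i : 'I_n.+1) := if i == ord_max then u else 1.
pose F i j : R := w i ^+ weight j *
  (plancherel (a i * (gamma * (1 - v i))) (Defs.skew Q (l i) j) *
   plancherel ((a (ordS i))^-1 * (gamma * (1 - v i))) (Defs.skew P (l (ordS i)) j)).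
transitivity (\sum_(mu \in [set: {ffun 'I_n.+1 -> intpart}])
    \prod_(i < n.+1) F i (mu i)).
  apply: eq_fsbigr => mu _; rewrite [RHS]big_split /=; congr (_ * _); last first.
    by apply: eq_bigr => i _; rewrite rmE rpE.
  rewrite (bigD1 ord_max) //= /w eqxx big1 ?mulr1 // => i /negbTE->.
  by rewrite expr1n.
rewrite (@fsum_ffun_prod _ _ _ (parts_le D)) ?parts_le_uniq //; last first.
  move=> i j; rewrite mem_parts_le -ltnNge => Dj.
  rewrite /F (skew_eq0 (dual_bases_sym PQ)) ?plancherel0 ?mul0r ?mulr0 //.
  exact: leq_ltn_trans (lD i) Dj.
rewrite (eq_bigr (fun i => potential (a i) (l i) / potential (a (ordS i)) (l (ordS i)) *
  ((expR ((1 - t) / (1 - q) * gamma ^+ 2 * (v i - 1)))^-1 *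
   Tmatrix q t P gamma (l i) (l (ordS i)) (v i)))); last first.
  by move=> i _; apply: skew_factor.
rewrite big_split /= (@prod_cyclic_ratio _ _ (fun i => potential (a i) (l i))).
  by rewrite mul1r big_split /= prodfV.
by move=> i; exact: potential_neq0.
Qed.

End Weight.

(** * Normalization *)

(** Countable additivity, transported along an injection of T into the natural
    numbers. *)
Lemma esum_fibres (R : realType) (d : measure_display) (Omega : measurableType d)
    (mu : {measure set Omega -> \bar R}) (T : countType) (f : Omega -> T) :
  (forall x, measurable (f @^-1` [set x])) ->
  (\esum_(x in [set: T]) mu (f @^-1` [set x]) = mu setT)%E.
Proof.
move=> mf; pose g := choice.pickle \o f.
have mg n : measurable (g @^-1` [set n]).
  have [[x xn]|no] := pselect (exists x : T, choice.pickle x = n).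
    have -> : g @^-1` [set n] = f @^-1` [set x]; last exact: mf.
    apply/seteqP; split => w /=; rewrite /g /= -xn; last by move=> ->.
    exact: (pcan_inj choice.pickleK).
  have -> : g @^-1` [set n] = set0; last exact: measurable0.
  by apply/seteqP; split => w //= gw; apply: no; exists (f w).
have -> : \esum_(x in [set: T]) mu (f @^-1` [set x]) =
    \esum_(n in choice.pickle @` [set: T]) mu (g @^-1` [set n]).
  rewrite esum_image; last by move=> x y _ _; exact: (pcan_inj choice.pickleK).
  apply: eq_esum => x _; congr (mu _); apply/seteqP; split => w /=; rewrite /g /=.
    by move=> ->.
  exact: (pcan_inj choice.pickleK).
rewrite esum_mkcond.
rewrite (eq_esum (b := fun n => mu (g @^-1` [set n]))) => [|n _]; last first.
  case: ifPn => // /negP nT.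
  have -> : g @^-1` [set n] = set0; last by rewrite measure0.
  apply/seteqP; split => w //= gw; apply: nT; apply/mem_set.
  by exists (f w).
rewrite -nneseries_esumT // -measure_semi_bigcup //.
- congr (mu _); apply/seteqP; split => w //= _; by exists (g w).
- exact: trivIset_preimage1.
- exact: bigcup_measurable.
Qed.

Lemma qpochhammer_ge0 (R : realType) (r : R) : 0 < r < 1 -> 0 <= qpochhammer r r.
Proof.
case/andP => r0 r1; pose a k : R := 1 - r * r ^+ k.
have a0 k : 0 <= a k.
  by rewrite subr_ge0 -exprS exprn_ile1 // ltW.
have a1 k : a k <= 1 by rewrite gerBl mulr_ge0 ?exprn_ge0 // ltW.
have p0 n : 0 <= \prod_(k < n) a k by apply: prodr_ge0.
rewrite /qpochhammer; apply: limr_ge; last by apply: nearW => n; exact: p0.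
apply: nonincreasing_is_cvgn; last by exists 0 => _ [n _ <-]; exact: p0.
apply/nonincreasing_seqP => n; rewrite big_ord_recr /=.
by apply: ler_piMr; [exact: p0|exact: a1].
Qed.

(** * Proportionality of the two laws *)

Theorem proposition4p4 (R : realType) (q t gamma beta : R)
  (hq : 0 < q < 1) (ht : 0 < t < 1) (hgamma : 0 < gamma) (hbeta : 0 < beta)
  (P : intpart -> Lambda R) (hP : is_macdonald q t P)
  (d : measure_display) (Omega : measurableType d) (Pr : probability Omega R)
  (X : R -> Omega -> intpart)
  (hX : periodic_macdonald_plancherel q t gamma beta P Pr X)
  (n : nat) (b : nat -> R)
  (hb0 : b 0%N = 0) (hb : forall i, (i <= n)%N -> b i < b i.+1)
  (hbn : b n.+1 = beta)
  (rp rm : 'I_n.+1 -> Lambda R -> R)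
  (hrp0 : rp ord0 = plancherel (gamma * (1 - expR (b n - beta))))
  (hrp : forall i : 'I_n.+1, (0 < i)%N ->
     rp i = plancherel (gamma * (expR (b i) - expR (b i.-1))))
  (hrm : forall i : 'I_n.+1,
     rm i = plancherel (gamma * (expR (- b i) - expR (- b i.+1))))
  (l : {ffun 'I_n.+1 -> intpart}) :
  Pr [set w | forall i : 'I_n.+1, X (b i) w = l i] =
  (periodic_macdonald q t (expR (- beta)) P rp rm l)%:E.
Proof.
pose a (i : 'I_n.+1) := expR (- b i).
pose v (i : 'I_n.+1) := expR (- (b i.+1 - b i)).
have a0 i : a i != 0 by rewrite gt_eqF ?expR_gt0.
have ordSE (i : 'I_n.+1) : i != ord_max -> ordS i = i.+1 :> nat.
  move=> im; rewrite /= modn_small // ltnS ltn_neqAle -ltnS ltn_ord andbT.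
  exact: im.
have ordS_max : ordS (@ord_max n) = ord0 by apply: val_inj; rewrite /= modnn.
have vE i : v i = (if i == ord_max then expR (- beta) else 1) / a i * a (ordS i).
  rewrite /v /a; case: (eqVneq i ord_max) => [->|im].
    by rewrite ordS_max /= hb0 oppr0 expR0 mulr1 -expRN -expRD hbn opprB opprK addrC.
  by rewrite (ordSE i im) mul1r -expRN -expRD opprB opprK.
have rmE i : rm i = plancherel (a i * (gamma * (1 - v i))).
  rewrite hrm; congr plancherel; rewrite /a /v.
  have -> : - b i.+1 = - b i + - (b i.+1 - b i) by ring.
  by rewrite expRD; ring.
have rpE i : rp (ordS i) = plancherel ((a (ordS i))^-1 * (gamma * (1 - v i))).
  rewrite /a /v; case: (eqVneq i ord_max) => [->|im].
    rewrite ordS_max hrp0 /= hb0 oppr0 expR0 invr1 mul1r hbn.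
    by rewrite opprB.
  rewrite hrp ?(ordSE i im) //=; congr plancherel.
  have -> : expR (b i) = expR (b i.+1) * expR (- (b i.+1 - b i)).
    by rewrite -expRD; congr expR; ring.
  by rewrite -expRN opprK; ring.
pose K := qpochhammer (expR (- beta)) (expR (- beta)).
pose c := (\prod_(i < n.+1) expR ((1 - t) / (1 - q) * gamma ^+ 2 * (v i - 1)))^-1.
pose T (k : {ffun 'I_n.+1 -> intpart}) :=
  \prod_(i < n.+1) Tmatrix q t P gamma (k i) (k (ordS i)) (v i).
have weightE k : periodic_macdonald_weight q t (expR (- beta)) P rp rm k = c * T k.
  exact: (weight_prod hq ht hP k a0 vE rmE rpE).
have c0 : 0 < c by rewrite invr_gt0 prodr_gt0 // => i _; exact: expR_gt0.
have [mX _ /(_ n b hb0 hb hbn) PrE] := hX.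
pose f w : {ffun 'I_n.+1 -> intpart} := [ffun i : 'I_n.+1 => X (b i) w].
have fE (k : {ffun 'I_n.+1 -> intpart}) :
    [set w | forall i : 'I_n.+1, X (b i) w = k i] = f @^-1` [set k].
  apply/seteqP; split => w /=; first by move=> h; apply/ffunP => i; rewrite ffunE.
  by move=> <- i; rewrite ffunE.
have mf k : measurable (f @^-1` [set k]).
  rewrite -fE (_ : [set w | _] = \bigcap_(i in [set: 'I_n.+1]) (X (b i) @^-1` [set k i])).
    by apply: fin_bigcap_measurable => // i _; exact: mX.
  by apply/seteqP; split => w /= h i; [move=> _; exact: h|exact: (h i)].
(* Otherwise all probabilities would vanish, but they sum to 1. *)
have K0 : 0 < K.
  have r01 : 0 < expR (- beta) < 1.
    by rewrite expR_gt0 /= -expR0 ltr_expR oppr_lt0.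
  rewrite lt_neqAle qpochhammer_ge0 // andbT; apply/eqP => K0.
  have : (\esum_(k in [set: {ffun 'I_n.+1 -> intpart}]) Pr (f @^-1` [set k]) = 1)%E.
    by rewrite (esum_fibres Pr mf); exact: probability_setT.
  rewrite esum1 => [/eqP|k _]; first by rewrite eq_sym onee_eq0.
  by rewrite -fE PrE -/K -K0 mul0r.
have ck0 : 0 <= c / K by rewrite divr_ge0 ?ltW.
(* The same summation, applied to c / K times the probability measure. *)
have sumE : \esum_(k in [set: {ffun 'I_n.+1 -> intpart}])
    (periodic_macdonald_weight q t (expR (- beta)) P rp rm k)%:E = (c / K)%:E.
  have <- : mscale (NngNum ck0) Pr setT = (c / K)%:E.
    by rewrite -[RHS]mule1; congr (_ * _)%E; exact: probability_setT.
  rewrite -(esum_fibres (mscale (NngNum ck0) Pr) mf).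
  apply: eq_esum => k _; transitivity ((c / K)%:E * Pr (f @^-1` [set k]))%E => //.
  rewrite -fE PrE -/K -EFinM weightE; congr (_%:E).
  by rewrite -/(T k) mulrA mulfVK // gt_eqF.
rewrite PrE /periodic_macdonald sumE weightE /= -/K -/(T l); congr (_%:E).
by field; rewrite !gt_eqF.
Qed.
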